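(* The distortion exponent achieved by the list decoding (LD) scheme is $$\Delta_{ld}(b,\nu)=\max\left\{\nu,\; b\,\frac{\Phi_k+k\Upsilon_k+\nu}{\Upsilon_k+b}\right\}\quad\text{for } b\in\left[\frac{\Phi_{k+1}+\nu}{k+1},\frac{\Phi_k+\nu}{k}\right),\ k=0,1,\dots,M_*-1$$ (for $k=0$ the right endpoint is $+\infty$).
   Context: All logarithms are base 2. Let $M_t,M_r\ge1$ be integers, $M^*=\max\{M_t,M_r\}$, $M_*=\min\{M_t,M_r\}$. A block $S^m$ of i.i.d. $\mathcal{CN}(0,1)$ source samples is sent over one block of $n$ uses of the MIMO channel $\mathbf Y_i=\sqrt{\rho/M_t}\,\mathbf H\mathbf x_i+\mathbf N_i$, where $\rho>0$ is the SNR, $\mathbf H\in\mathbb C^{M_r\times M_t}$ has i.i.d. $\mathcal{CN}(0,1)$ entries, constant over the block, $\mathbf N_i\sim\mathcal{CN}(0,\mathbf I)$ i.i.d., under the power constraint $\sum_i\mathrm{Tr}\,\mathbb E[\mathbf X_i^H\mathbf X_i]\le nM_t$. The receiver also observes $T^m=\sqrt{\rho_s}\Gamma_cS^m+Z^m$ with $\Gamma_c\sim\mathcal{CN}(0,1)$ constant over the block and unit-variance Gaussian noise $Z^m$; $\Gamma=|\Gamma_c|^2$ has density $e^{-\gamma}$, $\gamma\ge0$. All random quantities are independent; the receiver knows $\mathbf H,\gamma$, the transmitter only their distributions. $b=n/m$ is the bandwidth ratio, and $\rho_s\doteq\rho^{\nu}$ with $\nu\ge0$ ($f\doteq g$ means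 $\lim_{\rho\to\infty}\log f/\log g=1$). The distortion exponent of an expected distortion $\mathbb E[D]$ is $-\lim_{\rho\to\infty}\log\mathbb E[D]/\log\rho$. Define $D_d(R,\gamma)=(\rho_s\gamma+2^R)^{-1}$. LD scheme: the source is quantized with a Gaussian test channel $W=S+Q$ at rate $bR$ (no binning), the quantization index is sent with an i.i.d. Gaussian channel codebook, and the receiver decodes by list decoding the channel output and selecting the unique list element jointly typical with $T^m$; the source is reconstructed by MMSE from the decoded codeword and $T^m$, or from $T^m$ alone on failure. For rate $R\ge0$ and a fixed arbitrarily small $\epsilon>0$ its outage event is $\mathcal O_{ld}=\{(\mathbf H,\gamma):\log(1+\frac{2^{bR-\epsilon}-1}{\gamma\rho_s+1})\ge b\log\det(\mathbf I+\frac{\rho}{M_*}\mathbf H\mathbf H^H)\}$ and its expected distortion is $ED_{ld}(R)=\mathbb E[D_d(bR,\Gamma)\mathbf 1_{\mathcal O_{ld}^c}+D_d(0,\Gamma)\mathbf 1_{\mathcal O_{ld}}]$. The distortion exponent achieved by LD is the supremum over $r\ge0$ of the distortion exponent of $ED_{ld}(r\log\rho)$. For $k=0,\dots,M_*$: $\Phi_k=(M^*-k)(M_*-k)$, $\Upsilon_k=M^*+M_*-2k-1$. *)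

(* Defs.v *)
From HB Require Import structures.
From mathcomp Require Import all_boot all_order all_algebra.
From mathcomp Require Import all_classical all_reals all_analysis.
From mathcomp Require Import normal_distribution exponential_distribution.
From mathcomp Require Import complex.

Import Order.TTheory GRing.Theory Num.Theory.
Import numFieldNormedType.Exports.
Local Open Scope classical_set_scope.
Local Open Scope ring_scope.

Definition log2 {R : realType} (x : R) : R := ln x / ln 2.
Definition pow2 {R : realType} (x : R) : R := expR (x * ln 2).

Definition Mhi (Mt Mr : nat) : nat := maxn Mt Mr.
Definition Mlo (Mt Mr : nat) : nat := minn Mt Mr.

Definition Phi {R : realType} (Mt Mr k : nat) : R :=
  ((Mhi Mt Mr)%:R - k%:R) * ((Mlo Mt Mr)%:R - k%:R).
Definition Ups {R : realType} (Mt Mr k : nat) : R :=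
  (Mhi Mt Mr)%:R + (Mlo Mt Mr)%:R - 2 * k%:R - 1.

Definition Dd {R : realType} (rhos Rt gam : R) : R := (rhos * gam + pow2 Rt)^-1.

Definition chanH {R : realType} {Mr Mt : nat} (Hre Him : 'I_Mr -> 'I_Mt -> R)
  : 'M[R[i]]_(Mr, Mt) := \matrix_(i, j) (Hre i j +i* Him i j)%C.

Definition herm {R : realType} {m n} (A : 'M[R[i]]_(m, n)) : 'M[R[i]]_(n, m) :=
  map_mx (@conjc R) A^T.

(* log det (I + rho/M_* H H^H); the determinant is real (and >= 1), we take
   its real part *)
Definition logdet {R : realType} (Mt Mr : nat) (rho : R)
  (H : 'M[R[i]]_(Mr, Mt)) : R :=
  log2 (complex.Re (\det (1%:M + ((rho / (Mlo Mt Mr)%:R)%:C)%C *: (H *m herm H)))).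

(* outage event of LD for rate Rt, SNR rho, side SNR rhos, bandwidth ratio b *)
Definition outage_ld {R : realType} (Mt Mr : nat) (b eps rho rhos Rt : R)
  (H : 'M[R[i]]_(Mr, Mt)) (gam : R) : Prop :=
  log2 (1 + (pow2 (b * Rt - eps) - 1) / (gam * rhos + 1)) >= b * logdet Mt Mr rho H.

Definition Dld {R : realType} (Mt Mr : nat) (b eps rho rhos Rt : R)
  (H : 'M[R[i]]_(Mr, Mt)) (gam : R) : R :=
  if `[< outage_ld Mt Mr b eps rho rhos Rt H gam >] then Dd rhos 0 gam
  else Dd rhos (b * Rt) gam.

Definition mutually_independent {d} {T : measurableType d} {R : realType}
  (P : probability T R) {I : finType} (X : I -> T -> R) : Prop :=
  forall B : I -> set R, (forall i, measurable (B i)) ->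
    P (\bigcap_i (X i @^-1` B i)) = (\prod_(i : I) P (X i @^-1` B i))%E.

Definition rv_family {d} {T : measurableType d} {R : realType} {Mr Mt : nat}
  (Hre Him : 'I_Mr -> 'I_Mt -> T -> R) (Gam : T -> R)
  : option ('I_Mr * 'I_Mt * bool) -> T -> R :=
  fun o => match o with
           | Some (i, j, true) => Hre i j
           | Some (i, j, false) => Him i j
           | None => Gam
           end.

Definition ED_ld {d} {T : measurableType d} {R : realType} (P : probability T R)
  {Mt Mr : nat} (Hre Him : 'I_Mr -> 'I_Mt -> T -> R) (Gam : T -> R)
  (b eps rhos rho Rt : R) : R :=
  fine (\int[P]_t (Dld Mt Mr b eps rho rhos Rt
                     (chanH (fun i j => Hre i j t) (fun i j => Him i j t)) (Gam t))%:E)%E.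

Definition Delta_ld {R : realType} (Mt Mr k : nat) (b nu : R) : R :=
  Num.max nu (b * (Phi Mt Mr k + k%:R * Ups Mt Mr k + nu) / (Ups Mt Mr k + b)).

(* Main.v *)
(** The expected distortion has two competing sources: the quantization error,
    of exponent [max nu (b r)], and outage, of exponent [dmt r + nu], where
    [dmt] is the diversity-multiplexing trade-off of the channel, i.e. the decay
    exponent of [P (det (1 + rho H H^* ) <= rho^r)].  The exponent at rate [r]
    is the smaller of the two; the supremum over [r] is reached where they
    balance.

    The trade-off is obtained without eigenvalue densities, by Gaussian
    elimination.  If the pivot [a] dominates its row and column up to a constant
    factor, then [det (1 + rho H H^* )] equals [(1 + rho |a|^2)] times the same
    determinant of the Schur complement, up to a constant factor.  The Schur
    complement is again a matrix of fresh Gaussian entries, shifted by a function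
    of the pivot row and column, and a shift does not affect the order of
    magnitude of small-ball probabilities.  Hence a pivot step at size
    [|a|^2 = rho^-alpha] costs [rho^(- alpha (m + n - 1))] and gains a factor
    [rho^(1 - alpha)] in the determinant.  Choosing the entries of each pivot row
    and column in a fixed range gives the lower bound.  For the upper bound the
    largest entry is the pivot, and one proves, for every [lam >= 0], the
    Chernoff-type estimate
    [P (det <= s) <= C s^lam rho^(- sum_j min lam (m + n - 1 - 2 j) + eps)];
    the slopes of [dmt] are the relevant values of [lam]. *)

Require Import Defs.
From HB Require Import structures.
From mathcomp Require Import all_boot all_order all_algebra.
From mathcomp Require Import all_classical all_reals all_analysis.
From mathcomp Require Import normal_distribution exponential_distribution.
From mathcomp Require Import complex measurable_realfun.
From mathcomp Require Import ring lra.
Import Order.TTheory GRing.Theory Num.Theory.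
Import numFieldNormedType.Exports.
Local Open Scope classical_set_scope.
Local Open Scope ring_scope.

(** * Determinants [det (1 + N N^* )] and Gaussian elimination *)

(** Independence enters only through bounds of the form [Pr (A and E) <= p * Pr A] (or [>=]), where
    [A] is any event of the variables revealed so far and [p] depends neither on [A] nor on the
    shifts. They play the part of conditional probabilities and they compose: once a pivot row and
    column are revealed, the pivot event joins [A] and the induction hypothesis applies to the Schur
    complement. The two directions differ. The Gaussian density is bounded above everywhere, so the
    upper bound tolerates arbitrary shifts; it is bounded below only on bounded sets, so the lower
    bound has to keep the shifts bounded on [A]. No integral over a continuous size is computed. The
    pivot size is cut into a grid of about [L] levels in ratio [rho^(1/L)]: an arbitrarily small
    power of [rho] absorbs the ratio of neighbouring levels, and the number of levels is a constant.
    The same grid for [Gam] shows that the mean of [1 / (rhos Gam + 1)] is about [rho^(- nu)]. *)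

Section Gram.
Context {R : realType}.
Local Notation C := R[i].

Lemma hermK {m n} (A : 'M[C]_(m, n)) : herm (herm A) = A.
Proof. by apply/matrixP => i j; rewrite !mxE conjcK. Qed.

Lemma hermM {m n p} (A : 'M[C]_(m, n)) (B : 'M[C]_(n, p)) :
  herm (A *m B) = herm B *m herm A.
Proof. by rewrite /herm trmx_mul map_mxM. Qed.

Lemma hermD {m n} (A B : 'M[C]_(m, n)) : herm (A + B) = herm A + herm B.
Proof. by rewrite /herm linearD /= map_mxD. Qed.

Lemma herm1 {n} : herm (1%:M : 'M[C]_n) = 1%:M.
Proof. by rewrite /herm trmx1 map_mx1. Qed.

Lemma herm_row {m p q} (A : 'M[C]_(m, p)) (B : 'M[C]_(m, q)) :
  herm (row_mx A B) = col_mx (herm A) (herm B).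
Proof. by rewrite /herm tr_row_mx map_col_mx. Qed.

Definition sqn {n} (v : 'rV[C]_n) : C := (v *m herm v) 0 0.

Lemma sqnE {n} (v : 'rV[C]_n) : sqn v = \sum_j `|v 0 j| ^+ 2.
Proof.
rewrite /sqn mxE; apply: eq_bigr => j _; rewrite !mxE.
by rewrite sqr_normc.
Qed.

Lemma sqn_ge0 {n} (v : 'rV[C]_n) : 0 <= sqn v.
Proof. by rewrite sqnE sumr_ge0 // => j _; rewrite exprn_ge0. Qed.

Lemma sqn_eq0 {n} (v : 'rV[C]_n) : sqn v = 0 -> v = 0.
Proof.
move=> /eqP; rewrite sqnE psumr_eq0 => [|j _]; last by rewrite exprn_ge0.
move=> /allP v0; apply/rowP => j; rewrite mxE.
by have := v0 j (mem_index_enum _); rewrite /= sqrf_eq0 normr_eq0 => /eqP.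
Qed.

(** Sylvester's identity: clearing either off-diagonal block of [M] by a unitriangular factor
    computes [\det M] in two ways. *)
Lemma det_addmulC {m n} (A : 'M[C]_(m, n)) (B : 'M[C]_(n, m)) :
  \det (1%:M + A *m B) = \det (1%:M + B *m A).
Proof.
pose M := block_mx 1%:M (- A) B 1%:M.
have E1 : block_mx 1%:M 0 (- B) 1%:M *m M = block_mx 1%:M (- A) 0 (1%:M + B *m A).
  rewrite /M mulmx_block !mul1mx !mulmx1 !mul0mx !addr0 addNr; congr block_mx.
  by rewrite mulNmx mulmxN opprK addrC.
have E2 : block_mx 1%:M A 0 1%:M *m M = block_mx (1%:M + A *m B) 0 B 1%:M.
  by rewrite /M mulmx_block !mul1mx !mulmx1 !mul0mx !add0r addNr.
have := congr1 determinant E1; have := congr1 determinant E2.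
rewrite !det_mulmx !det_lblock !det_ublock !det1 !mul1r !mulr1.
by move=> -> ->.
Qed.

Definition gram {m p} (N : 'M[C]_(m, p)) : C := \det (1%:M + N *m herm N).

Lemma gram_herm {m p} (N : 'M[C]_(m, p)) : gram (herm N) = gram N.
Proof. by rewrite /gram hermK det_addmulC. Qed.

Lemma sqn_form {m p} (N : 'M[C]_(m, p)) (w : 'rV[C]_m) :
  (w *m (1%:M + N *m herm N) *m herm w) 0 0 = sqn w + sqn (w *m N).
Proof.
rewrite /sqn mulmxDr mulmxDl mulmx1 mxE; congr (_ + _).
by rewrite hermM !mulmxA.
Qed.

Lemma gram_unit {m p} (N : 'M[C]_(m, p)) : (1%:M + N *m herm N) \in unitmx.
Proof.
rewrite unitmxE unitfE; apply/negP => /det0P [v v0 vA].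
have := sqn_form N v; rewrite vA mul0mx mxE => /esym/eqP.
rewrite paddr_eq0 ?sqn_ge0 // => /andP[/eqP /sqn_eq0 v1 _].
by rewrite v1 eqxx in v0.
Qed.

Lemma entry_le_of_sub (a b c d : 'M[C]_1) : c = b ->
  0 <= (a - b - (c - d)) 0 0 -> a 0 0 <= b 0 0 -> b 0 0 <= d 0 0.
Proof.
move=> ->; rewrite !mxE => h; rewrite -subr_ge0 => /(addr_ge0 h).
rewrite -(subr_ge0 (b 0 0)); move: (a 0 0) (b 0 0) (d 0 0) => x y z.
by congr (0 <= _); ring.
Qed.

(** The matrix determinant lemma, with [q = v^* A^-1 v] for [A = 1 + N N^*]; since [A >= 1], this
    [q] lies between 0 and [|v|^2]. *)
Lemma gram_row {m p} (v : 'cV[C]_m) (N : 'M[C]_(m, p)) :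
  exists q : C, [/\ 0 <= q, q <= sqn (herm v) &
    gram (row_mx v N) = gram N * (1 + q)].
Proof.
set A := 1%:M + N *m herm N.
have uA : A \in unitmx by exact: gram_unit.
have hA : herm A = A by rewrite /A hermD herm1 hermM hermK.
pose w := herm v *m invmx A.
have wA : w *m A = herm v by rewrite /w mulmxKV.
exists ((w *m v) 0 0).
have qE : w *m v = w *m A *m herm w.
  by rewrite -mulmxA -{1}hA -hermM wA hermK.
have q_ge : sqn w <= (w *m v) 0 0.
  by rewrite qE sqn_form lerDl sqn_ge0.
have q0 : 0 <= (w *m v) 0 0 by apply: le_trans q_ge; exact: sqn_ge0.
split=> //.
(* Expanding this square gives [|w|^2 - 2 q + |v|^2 >= 0], and [|w|^2 <= q] turns it into
   [q <= |v|^2]. *)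
- have : 0 <= sqn (w - herm v) by exact: sqn_ge0.
  rewrite /sqn.
  have -> : herm (w - herm v) = herm w - v.
    by apply/matrixP => i j; rewrite !mxE rmorphB /= conjcK.
  rewrite (mulmxBl w (herm v)) (mulmxBr w) (mulmxBr (herm v)).
  move=> h; move: h q_ge; rewrite /sqn hermK; apply: entry_le_of_sub.
  by rewrite -wA -qE.
- rewrite /gram herm_row mul_row_col addrCA addrC -/A.
  rewrite -[A + _](_ : A *m (1%:M + (invmx A *m v) *m herm v) = _); last first.
    by rewrite mulmxDr mulmx1 !mulmxA mulmxV // mul1mx.
  rewrite det_mulmx (det_addmulC (invmx A *m v)) mulmxA -/w; congr (_ * _).
  by rewrite [X in \det X]mx11_scalar det_scalar1 !mxE eqxx.
Qed.

Lemma gram_ge1 {m p} (N : 'M[C]_(m, p)) : 1 <= gram N.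
Proof.
elim: p N => [|p IH] N.
  by rewrite /gram [N]thinmx0 mul0mx addr0 det1.
rewrite -[N](@hsubmxK _ m 1 p).
have [q [q0 _ ->]] := gram_row (lsubmx (N : 'M[C]_(m, 1 + p))) (rsubmx (N : 'M[C]_(m, 1 + p))).
have := IH (rsubmx (N : 'M[C]_(m, 1 + p))) => g1.
by rewrite -[X in X <= _]mulr1 ler_pM // lerDl.
Qed.
Lemma gram_gt0 {m p} (N : 'M[C]_(m, p)) : 0 < gram N.
Proof. exact: lt_le_trans ltr01 (gram_ge1 N). Qed.

Lemma gram_row_ge {m p} (v : 'cV[C]_m) (N : 'M[C]_(m, p)) :
  gram N <= gram (row_mx v N).
Proof.
have [q [q0 _ ->]] := gram_row v N.
by rewrite ler_peMr ?lerDl // ltW ?gram_gt0.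
Qed.

Lemma gram_row_le {m p} (v : 'cV[C]_m) (N : 'M[C]_(m, p)) :
  gram (row_mx v N) <= gram N * (1 + sqn (herm v)).
Proof.
have [q [q0 qv ->]] := gram_row v N.
by rewrite ler_wpM2l ?lerD2l // ltW ?gram_gt0.
Qed.

(* For [L = 1 + l e^*] with [e] a unit vector orthogonal to [l], one more column
   [e + 2 l] turns [L N] into [L] applied to [N] with the columns [e], [l], [l]
   added, because [L L^* + (e + l)(e + l)^* + 2 l l^* = 1 + (e + 2 l)(e + 2 l)^*]. *)
Lemma gram_shear {m p} (i0 : 'I_m) (l : 'cV[C]_m) (N : 'M[C]_(m, p)) :
  l i0 0 = 0 ->
  gram ((1%:M + l *m delta_mx 0 i0) *m N) <=
    gram N * ((1 + sqn (herm l)) * (1 + sqn (herm l)) * 2).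
Proof.
move=> l0; pose e : 'cV[C]_m := delta_mx i0 0.
have he : herm e = delta_mx 0 i0.
  by apply/matrixP => i j; rewrite !mxE andbC; case: (_ && _); rewrite ?conjc1 ?conjc0.
have el : delta_mx 0 i0 *m l = 0 :> 'M[C]_1.
  by apply/matrixP => i j; rewrite -rowE !mxE !ord1 l0.
have ee : herm e *m e = 1%:M.
  by rewrite he /e mul_delta_mx; apply/matrixP => i j; rewrite !ord1 !mxE !eqxx.
have le0 : herm l *m e = 0.
  by rewrite -[LHS]hermK hermM hermK he el; apply/matrixP => i j; rewrite !mxE conjc0.
set L := 1%:M + l *m delta_mx 0 i0; rewrite -he in el L *.
have detL : \det L = 1.
  rewrite /L det_addmulC el addr0; exact: det1.
have detLh : \det (herm L) = 1.
  by rewrite /L hermD herm1 hermM hermK det_addmulC le0 addr0; exact: det1.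
have Ll : L *m l = l by rewrite /L mulmxDl mul1mx -mulmxA el mulmx0 addr0.
have Le : L *m e = e + l by rewrite /L mulmxDl mul1mx -mulmxA ee mulmx1.
have LL : L *m herm L = 1%:M + l *m herm e + e *m herm l + l *m herm l.
  rewrite /L hermD herm1 hermM hermK mulmxDr mulmx1 mulmxDl mul1mx -!addrA.
  congr (_ + (_ + _)); congr (_ + _).
  by rewrite -mulmxA (mulmxA (herm e)) ee mul1mx.
apply: le_trans (gram_row_ge (e + (l + l)) (L *m N)) _.
pose M := row_mx e (row_mx l (row_mx l N)).
have -> : gram (row_mx (e + (l + l)) (L *m N)) = gram M.
  have -> : gram M = \det (L *m (1%:M + M *m herm M) *m herm L).
    by rewrite !det_mulmx detL detLh mul1r mulr1.
  rewrite /gram; congr (\det _).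
  rewrite mulmxDr mulmx1 mulmxDl LL -mulmxA -(mulmxA M) -hermM mulmxA.
  have -> : L *m M = row_mx (e + l) (row_mx l (row_mx l (L *m N))).
    by rewrite /M !mul_mx_row Le Ll.
  clear detL detLh Ll Le LL; clearbody L M.
  rewrite !herm_row !mul_row_col !hermD !mulmxDl !mulmxDr.
  move: (L *m N *m _) (e *m herm e) (e *m herm l) (l *m herm e) (l *m herm l).
  by move=> u x y z t; apply/matrixP => i j; rewrite !mxE; ring.
apply: le_trans (gram_row_le _ _) _.
have s0 : 0 <= sqn (herm l) := sqn_ge0 _.
have se : sqn (herm e) = 1.
  by rewrite /sqn hermK ee mxE eqxx.
rewrite se mulrA ler_wpM2r ?addr_ge0 ?ler01 // mulrA.
apply: le_trans (gram_row_le _ _) _; rewrite ler_wpM2r ?addr_ge0 ?ler01 //.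
exact: gram_row_le.
Qed.
(** For a zero pivot, [x / 0 = 0] makes this the plain minor, and [gram_schur] still holds. *)
Definition schur {m n} (i0 : 'I_m.+1) (j0 : 'I_n.+1) (K : 'M[C]_(m.+1, n.+1)) :
  'M[C]_(m, n) :=
  \matrix_(p, q) (K (lift i0 p) (lift j0 q)
                  - K (lift i0 p) j0 * K i0 (lift j0 q) / K i0 j0).

Definition shear {m} (i0 : 'I_m) (l : 'cV[C]_m) : 'M[C]_m :=
  1%:M + l *m delta_mx 0 i0.

Lemma shearE {m p} (i0 : 'I_m) (l : 'cV[C]_m) (X : 'M[C]_(m, p)) i j :
  (shear i0 l *m X) i j = X i j + l i 0 * X i0 j.
Proof.
rewrite /shear mulmxDl mul1mx -mulmxA -rowE mxE; congr (_ + _).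
by rewrite mxE big_ord1 !mxE.
Qed.

Lemma shear_hermE {m p} (j0 : 'I_p) (u : 'cV[C]_p) (X : 'M[C]_(m, p)) i j :
  (X *m herm (shear j0 u)) i j = X i j + conjc (u j 0) * X i j0.
Proof.
rewrite -[X *m _]hermK hermM hermK mxE mxE shearE !mxE.
by rewrite rmorphD rmorphM /= !conjcK.
Qed.

(* Row [i0] of [1 + D D^*] is [(1 + |D i0 j0|^2)] times a unit vector. *)
Lemma gram_diag {m n} (i0 : 'I_m.+1) (j0 : 'I_n.+1) (D : 'M[C]_(m.+1, n.+1)) :
  (forall p, p != i0 -> D p j0 = 0) -> (forall q, q != j0 -> D i0 q = 0) ->
  gram D = (1 + `|D i0 j0| ^+ 2) * gram (row' i0 (col' j0 D)).
Proof.
move=> D1 D2; rewrite /gram (expand_det_row _ i0) (bigD1 i0) //=.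
rewrite big1 ?addr0 => [|p pi0]; last first.
  rewrite mxE mxE eq_sym (negbTE pi0) mulr0n add0r [(_ *m _) _ _]mxE.
  rewrite big1 ?mul0r // => q _; rewrite [herm D _ _]mxE [D^T _ _]mxE.
  case: (eqVneq q j0) => [->|qj]; first by rewrite D1 ?conjc0 ?mulr0.
  by rewrite D2 // mul0r.
congr (_ * _).
  rewrite mxE mxE eqxx mulr1n; congr (_ + _).
  rewrite mxE (bigD1 j0) //= big1 ?addr0 => [|q qj]; last by rewrite D2 // mul0r.
  by rewrite !mxE sqr_normc.
rewrite /cofactor addnn -signr_odd odd_double expr0 mul1r; congr (\det _).
apply/matrixP => p q; rewrite !mxE (inj_eq lift_inj); congr (_ + _).
rewrite [LHS](bigD1_ord j0) //=.
rewrite D1; last by rewrite eq_sym neq_lift.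
rewrite mul0r add0r.
by apply: eq_bigr => k _; rewrite !mxE.
Qed.

Lemma sqn_le {n} (v : 'rV[C]_n) (kap : C) :
  (forall j, `|v 0 j| ^+ 2 <= kap) -> sqn v <= n%:R * kap.
Proof.
move=> vk; rewrite sqnE (le_trans (ler_sum _ (fun j _ => vk j))) //.
by rewrite sumr_const card_ord mulr_natl lexx.
Qed.

(** The factor of [gram_shear] when every entry of [l] has squared modulus at most 4. The ratio 4
    leaves room for both pivot choices: the largest entry gives ratio 1, the corner pivot of the
    lower bound gives 2. *)
Definition shear_cst (m : nat) : C :=
  (1 + m%:R * 4) * (1 + m%:R * 4) * 2.

Lemma gram_shear_le {m p} (i0 : 'I_m) (l : 'cV[C]_m) (N : 'M[C]_(m, p)) :
  l i0 0 = 0 -> (forall i, `|l i 0| ^+ 2 <= 4) ->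
  gram (shear i0 l *m N) <= gram N * shear_cst m.
Proof.
move=> l0 l1; apply: le_trans (gram_shear _ _ N l0) _.
rewrite ler_wpM2l ?(ltW (gram_gt0 _)) // ler_wpM2r ?ler0n //.
have s1 : sqn (herm l) <= m%:R * 4.
  by apply: sqn_le => j; rewrite !mxE normcJ.
by rewrite ler_pM ?addr_ge0 ?ler01 ?sqn_ge0 ?lerD2l.
Qed.

Lemma gram_shear2_le {m p} (i0 : 'I_m) (j0 : 'I_p) (l : 'cV[C]_m) (u : 'cV[C]_p)
    (N : 'M[C]_(m, p)) :
  l i0 0 = 0 -> (forall i, `|l i 0| ^+ 2 <= 4) ->
  u j0 0 = 0 -> (forall i, `|u i 0| ^+ 2 <= 4) ->
  gram (shear i0 l *m N *m herm (shear j0 u)) <=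
  gram N * (shear_cst m * shear_cst p).
Proof.
move=> l0 l1 u0 u1; rewrite -gram_herm hermM hermK.
apply: le_trans (gram_shear_le _ _ _ u0 u1) _; rewrite gram_herm mulrA.
apply: ler_wpM2r; last exact: gram_shear_le.
by rewrite /shear_cst !mulr_ge0 ?addr_ge0 ?mulr_ge0 ?ler0n ?ler01.
Qed.

(** Elimination multiplies [K] on both sides by shears whose entries are bounded through the pivot
    ratio. Their inverses are shears of the same kind, so [gram_shear2_le] compares [K] with its
    cleared form [D] in both directions. *)
Lemma gram_schur {m n} (i0 : 'I_m.+1) (j0 : 'I_n.+1) (K : 'M[C]_(m.+1, n.+1)) :
  (forall p, `|K p j0| ^+ 2 <= 4 * `|K i0 j0| ^+ 2) ->
  (forall q, `|K i0 q| ^+ 2 <= 4 * `|K i0 j0| ^+ 2) ->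
  let c := shear_cst m.+1 * shear_cst n.+1 in
  ((1 + `|K i0 j0| ^+ 2) * gram (schur i0 j0 K) <= gram K * c) /\
  (gram K <= (1 + `|K i0 j0| ^+ 2) * gram (schur i0 j0 K) * c).
Proof.
set a := K i0 j0 => Kp Kq c.
(* A zero pivot forces its row and column to vanish, so [K] is already cleared. *)
have [a0|a0] := eqVneq a 0.
  have c1 : 1 <= c.
    have k1 j : 1 <= shear_cst j.
      have j1 : 1 <= 1 + j%:R * 4 :> C by rewrite lerDl mulr_ge0 ?ler0n.
      by rewrite /shear_cst !mulr_ege1 // ler1n.
    exact: mulr_ege1.
  have z2 (z : C) : `|z| ^+ 2 <= 4 * `|a| ^+ 2 -> z = 0.
    rewrite a0 normr0 expr0n mulr0 => z0; apply/eqP.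
    by rewrite -normr_eq0 -sqrf_eq0 eq_le z0 exprn_ge0.
  have -> : schur i0 j0 K = row' i0 (col' j0 K).
    by apply/matrixP => p q; rewrite !mxE -/a a0 invr0 mulr0 subr0.
  have := gram_diag i0 j0 K (fun p _ => z2 _ (Kp p)) (fun q _ => z2 _ (Kq q)).
  move=> <-; have K0 : 0 <= gram K := ltW (gram_gt0 K).
  by split; rewrite ler_peMr.
have a2 : 0 < `|a| ^+ 2 by rewrite exprn_gt0 // normr_gt0.
pose l : 'cV[C]_m.+1 := \col_p (if p == i0 then 0 else K p j0 / a).
pose u : 'cV[C]_n.+1 := \col_q (if q == j0 then 0 else conjc (K i0 q / a)).
pose D := shear i0 (- l) *m K *m herm (shear j0 (- u)).
have l0 : l i0 0 = 0 by rewrite mxE eqxx.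
have u0 : u j0 0 = 0 by rewrite mxE eqxx.
have l1 i : `|l i 0| ^+ 2 <= 4.
  rewrite mxE; case: ifP => _; first by rewrite normr0 expr0n ler0n.
  by rewrite normrM normfV exprMn exprVn ler_pdivrMr.
have u1 i : `|u i 0| ^+ 2 <= 4.
  rewrite mxE; case: ifP => _; first by rewrite normr0 expr0n ler0n.
  by rewrite normcJ normrM normfV exprMn exprVn ler_pdivrMr.
have DE p q : D p q = K p q - l p 0 * K i0 q - conjc (u q 0) * (K p j0 - l p 0 * a).
  have oppE k (X : 'cV[C]_k) i : (- X) i 0 = - X i 0 by rewrite mxE.
  by rewrite /D shear_hermE !shearE !oppE rmorphN /= -/a; ring.
have KD : K = shear i0 l *m D *m herm (shear j0 u).
  apply/matrixP => p q; rewrite shear_hermE !shearE !DE l0 u0 conjc0 -/a -/l; ring.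
have D1 p : p != i0 -> D p j0 = 0.
  by move=> pi0; rewrite DE u0 conjc0 mxE (negbTE pi0) mul0r subr0 -/a divfK // subrr.
have D2 q : q != j0 -> D i0 q = 0.
  move=> qj; rewrite DE l0 !mul0r !subr0 mxE (negbTE qj) conjcK -/a divfK //.
  by rewrite subrr.
have Da : D i0 j0 = a by rewrite DE l0 u0 conjc0 !mul0r !subr0.
have Ds : row' i0 (col' j0 D) = schur i0 j0 K.
  apply/matrixP => p q; rewrite mxE mxE DE !mxE -/a.
  rewrite ![lift _ _ == _]eq_sym !(negbTE (neq_lift _ _)) conjcK divfK // subrr mulr0.
  by rewrite subr0 mulrAC.
have gD := gram_diag _ _ _ D1 D2; rewrite Da Ds in gD; rewrite -gD; split.
  by apply: gram_shear2_le => // [|i||i]; rewrite mxE ?l0 ?u0 ?oppr0 // normrN.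
rewrite {1}KD; exact: gram_shear2_le.
Qed.

End Gram.

(** * Gram determinants at a given SNR, as real numbers *)

Section Gdet.
Context {R : realType}.
Local Notation C := R[i].

Definition n2 (z : C) : R := complex.Re z ^+ 2 + complex.Im z ^+ 2.

Lemma n2E (z : C) : `|z| ^+ 2 = (n2 z)%:C%C.
Proof. by rewrite -add_Re2_Im2. Qed.

Lemma n2_ge0 (z : C) : 0 <= n2 z.
Proof. by rewrite addr_ge0 ?sqr_ge0. Qed.

Definition gdet {m n} (rho : R) (H : 'M[C]_(m, n)) : R :=
  complex.Re (\det (1%:M + (rho%:C)%C *: (H *m herm H))).

(** In the order of [C], being at least 1 includes being real, so [gram_ge1] shows that taking the
    real part loses nothing. *)
Lemma gdetE {m n} (rho : R) (H : 'M[C]_(m, n)) : 0 <= rho ->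
  (gdet rho H)%:C%C = gram ((Num.sqrt rho)%:C%C *: H).
Proof.
move=> rho0; suff E : \det (1%:M + (rho%:C)%C *: (H *m herm H)) =
    gram ((Num.sqrt rho)%:C%C *: H).
  by rewrite /gdet E RRe_real // ger0_real // (le_trans ler01) // gram_ge1.
rewrite /gram; congr (\det (_ + _)).
rewrite -scalemxAl; have -> : herm ((Num.sqrt rho)%:C%C *: H) = (Num.sqrt rho)%:C%C *: herm H.
  by apply/matrixP => i j; rewrite !mxE rmorphM; congr (_ * _); exact: conjc_real.
by rewrite -scalemxAr scalerA -rmorphM -expr2 sqr_sqrtr.
Qed.

Lemma gdet_ge1 {m n} (rho : R) (H : 'M[C]_(m, n)) : 0 <= rho -> 1 <= gdet rho H.
Proof. by move=> rho0; rewrite -lecR gdetE // gram_ge1. Qed.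

Lemma gdet_row0 {n} (rho : R) (H : 'M[C]_(0, n)) : gdet rho H = 1.
Proof. by rewrite /gdet det_mx00. Qed.

Lemma gdet_col0 {m} (rho : R) (H : 'M[C]_(m, 0)) : gdet rho H = 1.
Proof. by rewrite /gdet [H]thinmx0 mul0mx scaler0 addr0 det1. Qed.

Lemma gdet_schur (m n : nat) : exists2 c : R, 1 <= c &
  forall rho (i0 : 'I_m.+1) (j0 : 'I_n.+1) (H : 'M[C]_(m.+1, n.+1)),
  0 < rho ->
  (forall p, n2 (H p j0) <= 4 * n2 (H i0 j0)) ->
  (forall q, n2 (H i0 q) <= 4 * n2 (H i0 j0)) ->
  ((1 + rho * n2 (H i0 j0)) * gdet rho (schur i0 j0 H) <= gdet rho H * c) /\
  (gdet rho H <= (1 + rho * n2 (H i0 j0)) * gdet rho (schur i0 j0 H) * c).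
Proof.
pose k (m : nat) : R := (1 + m%:R * 4) * (1 + m%:R * 4) * 2.
have kE j : (k j)%:C%C = shear_cst j.
  by rewrite /k /shear_cst !(rmorphM, rmorphD) /= !rmorph_nat rmorph1.
have k1 j : 1 <= k j.
  have j0 : 0 <= j%:R * 4 :> R by rewrite mulr_ge0.
  rewrite /k; nra.
exists (k m.+1 * k n.+1) => [|rho i0 j0 H rho0 Hp Hq].
  by rewrite -[1]mulr1 ler_pM.
have s0 : (Num.sqrt rho)%:C%C != 0 :> C.
  by rewrite -(rmorph0 (real_complex R)) (inj_eq (@complexI _)) gt_eqF // sqrtr_gt0.
have sN z : n2 ((Num.sqrt rho)%:C%C * z) = rho * n2 z.
  apply: (@complexI R); rewrite -n2E normrM exprMn n2E n2E -rmorphM /n2 /=.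
  by rewrite expr0n addr0 sqr_sqrtr // ltW.
set K := (Num.sqrt rho)%:C%C *: H.
have [||/=] := gram_schur i0 j0 K.
- by move=> p; rewrite !n2E -(rmorph_nat (real_complex R)) -rmorphM lecR /K !mxE
    !sN [rho * n2 (H i0 j0)]mulrC mulrA [_ * rho]mulrC ler_wpM2l // ltW.
- by move=> p; rewrite !n2E -(rmorph_nat (real_complex R)) -rmorphM lecR /K !mxE
    !sN [rho * n2 (H i0 j0)]mulrC mulrA [_ * rho]mulrC ler_wpM2l // ltW.
have -> : schur i0 j0 K = (Num.sqrt rho)%:C%C *: schur i0 j0 H.
  apply/matrixP => p q; rewrite !mxE.
  have [->|a0] := eqVneq (H i0 j0) 0; first by rewrite mulr0 invr0 !mulr0 !subr0.
  by field; rewrite a0 s0.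
rewrite n2E mxE sN -!gdetE ?(ltW rho0) // -!kE -(rmorph1 (real_complex R)).
by rewrite -!(rmorphM, rmorphD) /= !lecR.
Qed.

End Gdet.
(** * Independence and small-ball estimates *)

Section Independence.
Context {d : measure_display} {T : measurableType d} {R : realType}.
Context (P : probability T R) {I : finType} (X : I -> T -> R).
Hypothesis mX : forall i, measurable_fun setT (X i).
Hypothesis indep : mutually_independent P X.

(* [smeas S] and [sfun S] are the events and functions measurable with respect to
   the sigma-algebra generated by the [X i] with [i] in [S]. *)
Definition gens (S : {set I}) : set (set T) :=
  [set A | exists2 i, i \in S & exists2 B, measurable B & A = X i @^-1` B].

Definition smeas (S : {set I}) (A : set T) : Prop := <<s gens S >> A.
Definition sfun (S : {set I}) (f : T -> R) : Prop :=
  @measurable_fun _ _ (g_sigma_algebraType (gens S)) R setT f.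

Lemma gens_measurable S A : gens S A -> measurable A.
Proof. by case=> i _ [B mB ->]; rewrite -[_ @^-1` _]setTI; exact: mX. Qed.

Lemma smeas_measurable S A : smeas S A -> measurable A.
Proof.
apply: smallest_sub; last by move=> B /gens_measurable.
exact: sigma_algebra_measurable.
Qed.

Lemma smeasS (S S' : {set I}) A : S \subset S' -> smeas S A -> smeas S' A.
Proof.
move=> /fintype.subsetP SS; apply: sub_sigma_algebra2 => B [i iS [C mC ->]].
by exists i; [exact: SS|exists C].
Qed.

Lemma sfunS (S S' : {set I}) f : S \subset S' -> sfun S f -> sfun S' f.
Proof.
move=> SS mf _ B mB; apply: (smeasS S) => //.
exact: mf.
Qed.

Lemma sfun_var (S : {set I}) i : i \in S -> sfun S (X i).
Proof.
by move=> iS _ B mB; rewrite setTI; apply: sub_sigma_algebra; exists i => //; exists B.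
Qed.

(** The pi-system on which [indep] applies directly; [B i = setT] off [S] turns a statement about
    some of the variables into one about all of them. *)
Definition rects (S : {set I}) : set (set T) :=
  [set A | exists2 B : I -> set R, forall i, measurable (B i) /\ (i \notin S -> B i = setT) &
    A = \bigcap_i (X i @^-1` B i)].

Lemma gens_rects S : gens S `<=` rects S.
Proof.
move=> A [i iS [B mB ->]]; exists (fun j => if j == i then B else setT).
  move=> j; split; first by case: ifP.
  by move=> jS; case: eqP => // ji; rewrite ji iS in jS.
apply/seteqP; split => [t Bt j _ /=|t /(_ i Logic.I)]; last by rewrite /= eqxx.
by case: eqP => [->|].
Qed.

Lemma rects_setI S : setI_closed (rects S).
Proof.
move=> A A' [B mB ->] [B' mB' ->]; exists (fun i => B i `&` B' i).
  move=> i; split; first by apply: measurableI; [case: (mB i)|case: (mB' i)].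
  by move=> iS; rewrite (mB i).2 // (mB' i).2 // setTI.
by rewrite -bigcapI.
Qed.

Lemma rects_measurable S A : rects S A -> measurable A.
Proof.
move=> [B mB ->]; apply: fin_bigcap_measurable => //.
by move=> i _; rewrite -[_ @^-1` _]setTI; apply: mX => //; case: (mB i).
Qed.

(** Both sides are finite measures in [A]; they agree on the pi-system of rectangles, hence on the
    sigma-algebra that it generates. *)
Lemma smeas_indep (S : {set I}) i A B : i \notin S -> smeas S A -> measurable B ->
  P (A `&` X i @^-1` B) = (P A * P (X i @^-1` B))%E.
Proof.
move=> iS sA mB.
have mXB : measurable (X i @^-1` B) by rewrite -[_ @^-1` _]setTI; exact: mX.
pose p := fine (P (X i @^-1` B)).
have p0 : 0 <= p by rewrite fine_ge0.
have pE : P (X i @^-1` B) = p%:E by rewrite fineK ?fin_num_measure.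
pose m1 : {measure set T -> \bar R} := mrestr P mXB.
pose m2 : {measure set T -> \bar R} := mscale (NngNum p0) P.
have -> : P (A `&` X i @^-1` B) = m1 A by [].
rewrite pE muleC; have -> : (p%:E * P A)%E = m2 A by [].
have : <<s rects S >> A by apply: sub_sigma_algebra2 sA; exact: gens_rects.
move: A {sA}; apply: (g_sigma_algebra_measure_unique (rects S) _ (fun=> setT) _ _ m1 m2).
- by move=> ? /rects_measurable.
- move=> _; exists (fun=> setT) => //.
  by apply/seteqP; split.
- by apply/seteqP; split => // t _; exists 0%N.
- exact: rects_setI.
- move=> A [C mC ->].
  (* Since [i] is not in [S], side [i] of the rectangle is free, and the intersection is again a
     rectangle, with [B] as that side. *)
  have -> : m1 (\bigcap_i0 X i0 @^-1` C i0) =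
      P (\bigcap_j (X j @^-1` (if j == i then B else C j))).
    rewrite /m1 /mrestr /=; congr (P _); apply/seteqP; split.
    + by move=> t [/= h1 h2] j _ /=; case: eqP => [->|_] //; exact: h1.
    + move=> t /= h; split; last by have := h i Logic.I; rewrite /= eqxx.
      move=> j _ /=; have := h j Logic.I; rewrite /=; case: eqP => // -> _.
      by rewrite (mC i).2.
  have -> : m2 (\bigcap_i0 X i0 @^-1` C i0) =
      (p%:E * P (\bigcap_i0 X i0 @^-1` C i0))%E by [].
  rewrite !indep; last 2 first.
    by move=> j; case: (mC j).
    by move=> j; case: eqP => // _; case: (mC j).
  rewrite [LHS](bigD1 i) //= eqxx -pE [in RHS](bigD1 i) //= (mC i).2 // preimage_setT.
  rewrite probability_setT mul1e; congr (_ * _)%E.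
  by apply: eq_bigr => j /negbTE ->.
- move=> _; rewrite /m1 /= /mrestr setTI.
  by rewrite (le_lt_trans (probability_le1 _ _)) // ltry.
Qed.

End Independence.

(** * One fresh variable: interval bounds relative to past events *)

Section Steps.
Context {d : measure_display} {T : measurableType d} {R : realType}.
Context (P : probability T R).

Definition Pr (A : set T) : R := fine (P A).

Lemma PrE A : measurable A -> (Pr A)%:E = P A.
Proof. by move=> mA; rewrite /Pr fineK // fin_num_measure. Qed.

Lemma Pr_ge0 A : 0 <= Pr A.
Proof. exact: fine_ge0. Qed.

Lemma Pr_le1 A : measurable A -> Pr A <= 1.
Proof. by move=> mA; rewrite -lee_fin PrE // probability_le1. Qed.

Lemma Pr_le A B : measurable A -> measurable B -> A `<=` B -> Pr A <= Pr B.
Proof.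
by move=> mA mB AB; rewrite -lee_fin !PrE //; apply: le_measure; rewrite ?inE.
Qed.

Lemma Pr_cover {J : finType} (E : set T) (F : J -> set T) :
  measurable E -> (forall j, measurable (F j)) ->
  (forall t, E t -> exists j, F j t) -> Pr E <= \sum_j Pr (F j).
Proof.
move=> mE mF EF.
have mU (s : seq J) : measurable (\big[setU/set0]_(j <- s) F j).
  by elim/big_ind: _ => //; exact: measurableU.
have sub : Pr (\big[setU/set0]_(j : J) F j) <= \sum_j Pr (F j).
  elim: (index_enum J) => [|j s IH]; first by rewrite !big_nil /Pr measure0.
  rewrite !big_cons; apply: le_trans (lerD (lexx _) IH).
  rewrite -lee_fin EFinD !PrE //; last exact: measurableU.
  exact: measureU2.
apply: le_trans sub; apply: Pr_le => // t /EF [j Fj].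
by rewrite (bigD1 j) //=; left.
Qed.

(** Countable additivity over the values of [N]; with [N = cell del Y] it replaces conditioning on
    [Y]. The two factors let it serve upper and lower bounds alike. *)
Lemma Pr_fibers_le (A E E' : set T) (N : T -> nat) (p q : R) :
  0 <= p -> 0 <= q ->
  measurable A -> measurable E -> measurable E' ->
  (forall n, measurable (A `&` N @^-1` [set n])) ->
  (forall n, p * Pr (A `&` N @^-1` [set n] `&` E) <=
             q * Pr (A `&` N @^-1` [set n] `&` E')) ->
  p * Pr (A `&` E) <= q * Pr (A `&` E').
Proof.
move=> p0 q0 mA mE mE' mN h; pose G n := A `&` N @^-1` [set n].
have mG n : measurable (G n) := mN n.
have sumE F : measurable F -> (P (A `&` F) = \sum_(0 <= n <oo) P (G n `&` F))%E.
  move=> mF; rewrite -measure_semi_bigcup.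
  - congr (P _); rewrite -setI_bigcupl; congr (_ `&` _).
    by apply/seteqP; split => [t At|t [n _ []//]]; exists (N t).
  - by move=> n; apply: measurableI.
  - by apply/trivIsetP => i j _ _ ij; apply/seteqP; split => // t [[[_ /= Ni] _] [[_ /= Nj] _]];
      rewrite -Ni -Nj eqxx in ij.
  - by apply: bigcup_measurable => n _; apply: measurableI.
rewrite -lee_fin !EFinM !PrE; try exact: measurableI.
rewrite !sumE // -!nneseriesZl //.
apply: lee_nneseries => [n _ _|n _]; first by rewrite mule_ge0.
by rewrite -!PrE ?lee_fin; [exact: h|exact: measurableI|exact: measurableI].
Qed.

Context {I : finType} (X : I -> T -> R).
Hypothesis mX : forall i, measurable_fun setT (X i).
Hypothesis indep : mutually_independent P X.
Implicit Type S : {set I}.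

Local Notation smeas := (smeas X).
Local Notation sfun := (sfun X).

Lemma smeasI S A B : smeas S A -> smeas S B -> smeas S (A `&` B).
Proof. exact: (@measurableI _ (g_sigma_algebraType (gens X S))). Qed.

Lemma sfun_pre S f B : sfun S f -> measurable B -> smeas S (f @^-1` B).
Proof. by move=> mf mB; rewrite -[_ @^-1` _]setTI; exact: mf. Qed.

Lemma Pr_indep S i A B : i \notin S -> smeas S A -> measurable B ->
  Pr (A `&` X i @^-1` B) = Pr A * Pr (X i @^-1` B).
Proof.
move=> iS sA mB; rewrite /Pr (smeas_indep P X mX indep S) // fineM //.
  by rewrite fin_num_measure //; apply: smeas_measurable sA.
by rewrite fin_num_measure // -[_ @^-1` _]setTI; exact: mX.
Qed.

(* Independence of [X i] from a function [Y] of the other variables is only used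
   after cutting the range of [Y] into cells of length [del], where it reduces to
   independence of events. *)
Definition cell (del : R) (Y : T -> R) (t : T) : nat := pickle (Num.floor (Y t / del)).

Lemma cellP del Y t0 : 0 < del -> let c := (Num.floor (Y t0 / del))%:~R * del in
  [/\ c <= Y t0, Y t0 < c + del &
   cell del Y @^-1` [set cell del Y t0] = Y @^-1` `[c, c + del[%classic].
Proof.
move=> del0 c.
have H t : (Num.floor (Y t / del))%:~R * del <= Y t <
           (Num.floor (Y t / del))%:~R * del + del.
  have := floor_itv (Y t / del); rewrite ler_pdivlMr // ltr_pdivrMr //.
  by rewrite intrD mulrDl mul1r.
split; [by case/andP: (H t0)|by case/andP: (H t0)|].
apply/seteqP; split => t /=.
  by move=> /(pcan_inj (@pickleK _)) e; rewrite in_itv /= /c -e; exact: H.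
rewrite in_itv /= => /andP[h1 h2]; rewrite /cell; congr pickle.
apply: floor_def; rewrite ler_pdivlMr // ltr_pdivrMr // h1 /=.
by rewrite intrD mulrDl mul1r.
Qed.

Lemma cell_smeas S A Y del n : 0 < del -> smeas S A -> sfun S Y ->
  smeas S (A `&` cell del Y @^-1` [set n]).
Proof.
move=> del0 sA sY.
have [E|/set0P [t0 [At0 /= <-]]] := eqVneq (A `&` cell del Y @^-1` [set n]) set0.
  by rewrite E; exact: (@measurable0 _ (g_sigma_algebraType (gens X S))).
have [_ _ ->] := cellP del Y t0 del0.
by apply: smeasI => //; apply: sfun_pre.
Qed.

Lemma measurable_sfun S Y : sfun S Y -> measurable_fun setT Y.
Proof.
by move=> sY _ B mB; rewrite setTI; apply: (smeas_measurable X mX S); exact: sfun_pre.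
Qed.

(** On a cell [c <= Y < c + del] the event confines [X i] to [[- c - 2 del, - c + del]], whence the
    length [3 del]. *)
Lemma step_le S A Y i (p del : R) : 0 < del -> 0 <= p -> i \notin S ->
  smeas S A -> sfun S Y ->
  (forall c, Pr (X i @^-1` `[c, c + 3 * del]%classic) <= p) ->
  Pr (A `&` [set t | `|X i t + Y t| <= del]) <= p * Pr A.
Proof.
move=> del0 p0 iS sA sY hp.
have mA := smeas_measurable X mX S _ sA.
have mY := measurable_sfun S Y sY.
have mE : measurable [set t | `|X i t + Y t| <= del].
  rewrite -[X in measurable X]setTI.
  by apply: measurable_fun_le => //; apply: measurableT_comp => //; exact: measurable_funD.
have := Pr_fibers_le A _ setT (cell del Y) 1 p ler01 p0 mA mE measurableT.
rewrite mul1r setIT; apply.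
  by move=> n; apply: (smeas_measurable X mX S); exact: cell_smeas.
move=> n; rewrite mul1r setIT.
have [->|/set0P [t0 [At0 /= E]]] := eqVneq (A `&` cell del Y @^-1` [set n]) set0.
  by rewrite set0I /Pr measure0 mulr0.
have sG : smeas S (A `&` cell del Y @^-1` [set n]) by exact: cell_smeas.
have [_ _] := cellP del Y t0 del0.
set c := _%:~R * del; rewrite E => cE.
apply: le_trans (_ : Pr (A `&` cell del Y @^-1` [set n] `&`
    X i @^-1` `[- c - 2 * del, - c - 2 * del + 3 * del]%classic) <= _).
  have mG := smeas_measurable X mX S _ sG.
  apply: Pr_le; [exact: measurableI| |].
    by apply: measurableI => //; rewrite -[_ @^-1` _]setTI; exact: mX.
  move=> t [[At Nt] /=]; rewrite ler_norml => /andP[h1 h2]; split => //=.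
  move: Nt; rewrite cE /= !in_itv /= => /andP[h3 h4]; lra.
by rewrite (Pr_indep S) // mulrC ler_wpM2r // Pr_ge0.
Qed.

(** On a cell starting at [c], it suffices that [X i] lies in [[u - c, u - c + del]]. A cell that
    meets [A] has [|c| <= B + 1], so only intervals near the origin occur, where a Gaussian density
    has a positive lower bound. *)
Lemma step_ge S A Y i (p del u B : R) : 0 < del <= 1 -> 0 <= p -> i \notin S ->
  smeas S A -> sfun S Y -> (forall t, A t -> `|Y t| <= B) ->
  (forall c, `|c| <= B + `|u| + 1 -> p <= Pr (X i @^-1` `[c, c + del]%classic)) ->
  p * Pr A <= Pr (A `&` [set t | u <= X i t + Y t <= u + 2 * del]).
Proof.
move=> /andP[del0 del1] p0 iS sA sY YB hp.
have mA := smeas_measurable X mX S _ sA.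
have mY := measurable_sfun S Y sY.
have mE : measurable [set t | u <= X i t + Y t <= u + 2 * del].
  rewrite -[X in measurable X]setTI.
  have := measurable_funD (mX i) mY => /(_ measurableT `[u, u + 2 * del]%classic).
  by rewrite !setTI; apply; exact: measurable_itv.
have := Pr_fibers_le A setT _ (cell del Y) p 1 p0 ler01 mA measurableT mE.
rewrite mul1r setIT; apply.
  by move=> n; apply: (smeas_measurable X mX S); exact: cell_smeas.
move=> n; rewrite mul1r setIT.
have [->|/set0P [t0 [At0 /= E]]] := eqVneq (A `&` cell del Y @^-1` [set n]) set0.
  by rewrite set0I /Pr measure0 mulr0.
have sG : smeas S (A `&` cell del Y @^-1` [set n]) by exact: cell_smeas.
have [c1 c2] := cellP del Y t0 del0.
move: c1 c2; set c := _%:~R * del; rewrite E => c1 c2 cE.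
apply: le_trans (_ : _ <= Pr (A `&` cell del Y @^-1` [set n] `&`
    X i @^-1` `[u - c, u - c + del]%classic)) _.
  rewrite (Pr_indep S) // mulrC ler_wpM2l ?Pr_ge0 // hp //.
  have := YB _ At0; rewrite !ler_norml => /andP[h1 h2].
  have := ler_norm u; have := ler_norm (- u); rewrite normrN => h3 h4.
  by apply/andP; split; lra.
have mG := smeas_measurable X mX S _ sG.
apply: Pr_le; [|exact: measurableI|].
  by apply: measurableI => //; rewrite -[_ @^-1` _]setTI; exact: mX.
move=> t [[At Nt] /=]; rewrite in_itv /= => /andP[h1 h2]; split => //=.
move: Nt; rewrite cE /= !in_itv /= => /andP[h3 h4]; lra.
Qed.

End Steps.

(** * Several fresh variables in turn *)

Section ManySteps.
Context {d : measure_display} {T : measurableType d} {R : realType}.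
Context (P : probability T R) {I : finType} (X : I -> T -> R).
Hypothesis mX : forall i, measurable_fun setT (X i).
Hypothesis indep : mutually_independent P X.
Implicit Type S : {set I}.
Context {J : eqType} (ix : J -> I) (Y : J -> T -> R).

Lemma smeas_all S A (s : seq J) (F : J -> set T) :
  smeas X S A -> (forall j, j \in s -> smeas X S (F j)) ->
  smeas X S (A `&` [set t | forall j, j \in s -> F j t]).
Proof.
move=> sA; elim: s => [|j s IH] sF.
  by rewrite (_ : [set t | _] = setT) ?setIT //; apply/seteqP; split.
have := smeasI X S _ _ (IH (fun i is' => sF i (mem_behead (s := j :: s) is')))
  (sF j (mem_head _ _)).
congr (smeas X S _); apply/seteqP; split=> [t [[At h] Fj]|t [At h]].
  by split=> // i; rewrite inE => /orP[/eqP -> //|]; exact: h.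
split; last by apply: h; rewrite mem_head.
by split => // i is'; apply: h; rewrite inE is' orbT.
Qed.

Lemma sfun_shift S j : ix j \in S -> sfun X S (Y j) ->
  sfun X S (fun t => X (ix j) t + Y j t).
Proof. by move=> jS sY; apply: measurable_funD => //; exact: sfun_var. Qed.

Lemma smeas_le S j del : ix j \in S -> sfun X S (Y j) ->
  smeas X S [set t | `|X (ix j) t + Y j t| <= del].
Proof.
move=> jS sY; have := sfun_pre X S _ `[- del, del]%classic (sfun_shift S j jS sY).
move=> /(_ (measurable_itv _)); congr (smeas X S _).
by apply/seteqP; split => t /=; rewrite in_itv /= ler_norml.
Qed.

Lemma smeas_itv S j u v : ix j \in S -> sfun X S (Y j) ->
  smeas X S [set t | u <= X (ix j) t + Y j t <= v].
Proof.
move=> jS sY; have := sfun_pre X S _ `[u, v]%classic (sfun_shift S j jS sY).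
exact.
Qed.

Lemma cons_event A (s : seq J) j (F : J -> set T) :
  A `&` [set t | forall i, i \in j :: s -> F i t] =
  (A `&` [set t | forall i, i \in s -> F i t]) `&` F j.
Proof.
apply/seteqP; split=> [t [At h]|t [[At h] Fj]].
  split; last by apply: h; rewrite mem_head.
  by split => // i is'; apply: h; rewrite inE is' orbT.
by split=> // i; rewrite inE => /orP[/eqP -> //|]; exact: h.
Qed.

(** Each variable, once used, moves into [S']; the next one is still outside, hence independent of
    the event built so far. *)
Lemma steps_le S A (s : seq J) (p del : R) : 0 < del -> 0 <= p ->
  uniq (map ix s) -> (forall j, j \in s -> ix j \notin S) ->
  smeas X S A -> (forall j, j \in s -> sfun X S (Y j)) ->
  (forall j c, j \in s -> Pr P (X (ix j) @^-1` `[c, c + 3 * del]%classic) <= p) ->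
  Pr P (A `&` [set t | forall j, j \in s -> `|X (ix j) t + Y j t| <= del])
    <= p ^+ size s * Pr P A.
Proof.
move=> del0 p0; elim: s => [|j s IH] us sS sA sY hp.
  rewrite expr0 mul1r (_ : [set t | _] = setT) ?setIT //.
  by apply/seteqP; split.
move: us; rewrite /= => /andP[js us].
rewrite (cons_event A s j (fun j => [set t | `|X (ix j) t + Y j t| <= del])).
pose S' := S :|: [set i in map ix s].
have SS' : S \subset S' by exact: finset.subsetUl.
rewrite exprS -mulrA; apply: le_trans (_ : p * Pr P (A `&`
    [set t | forall i, i \in s -> `|X (ix i) t + Y i t| <= del]) <= _); last first.
  rewrite ler_wpM2l // IH // => i => [is'|is'|c is']; [apply: sS|apply: sY|apply: hp];
  by rewrite inE is' orbT.
apply: (step_le P X mX indep S') => //.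
- by rewrite !inE negb_or (negbTE js) andbT sS // mem_head.
- apply: (smeas_all S' A s (fun i => [set t | `|X (ix i) t + Y i t| <= del])).
    exact: smeasS sA.
  move=> i is'; apply: smeas_le; first by rewrite !inE map_f ?orbT.
  by apply: sfunS (sY i _) => //; rewrite inE is' orbT.
- by apply: sfunS (sY j _) => //; rewrite mem_head.
- by move=> c; apply: hp; rewrite mem_head.
Qed.

Lemma steps_ge S A (s : seq J) (u : J -> R) (p del B : R) : 0 < del <= 1 -> 0 <= p ->
  uniq (map ix s) -> (forall j, j \in s -> ix j \notin S) ->
  smeas X S A -> (forall j, j \in s -> sfun X S (Y j)) ->
  (forall j t, j \in s -> A t -> `|Y j t| <= B) ->
  (forall j, `|u j| <= 1) ->
  (forall j c, j \in s -> `|c| <= B + 2 ->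
     p <= Pr P (X (ix j) @^-1` `[c, c + del]%classic)) ->
  p ^+ size s * Pr P A <=
  Pr P (A `&` [set t | forall j, j \in s ->
                 u j <= X (ix j) t + Y j t <= u j + 2 * del]).
Proof.
move=> del0 p0; elim: s => [|j s IH] us sS sA sY YB u1 hp.
  rewrite expr0 mul1r (_ : [set t | _] = setT) ?setIT //.
  by apply/seteqP; split.
move: us; rewrite /= => /andP[js us].
rewrite (cons_event A s j (fun j => [set t | u j <= X (ix j) t + Y j t <= u j + 2 * del])).
pose S' := S :|: [set i in map ix s].
have SS' : S \subset S' by exact: finset.subsetUl.
rewrite exprS -mulrA; apply: le_trans (_ : p * Pr P (A `&`
    [set t | forall i, i \in s -> u i <= X (ix i) t + Y i t <= u i + 2 * del]) <= _).
  rewrite ler_wpM2l // IH // => i => [is'|is'|t is'|c is'];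
    [apply: sS|apply: sY|apply: YB|apply: hp];
  by rewrite inE is' orbT.
apply: (step_ge P X mX indep S' _ _ _ _ _ _ B) => //.
- by rewrite !inE negb_or (negbTE js) andbT sS // mem_head.
- apply: (smeas_all S' A s (fun i => [set t | u i <= X (ix i) t + Y i t <= u i + 2 * del])).
    exact: smeasS sA.
  move=> i is'; apply: smeas_itv; first by rewrite !inE map_f ?orbT.
  by apply: sfunS (sY i _) => //; rewrite inE is' orbT.
- by apply: sfunS (sY j _) => //; rewrite mem_head.
- by move=> t [At _]; apply: YB => //; rewrite mem_head.
- move=> c hc; apply: hp; rewrite ?mem_head //; apply: le_trans hc _.
  by have := u1 j; lra.
Qed.

End ManySteps.

(** * Interval probabilities of the Gaussian law of variance 1/2 *)

Section NormalLaw.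
Context {R : realType}.
Local Notation sg := (Num.sqrt (2^-1) : R).

(** For variance 1/2 the peak is [1 / sqrt pi], so that an interval has probability at most its
    length. *)
Lemma normal_peak_le1 : normal_peak sg <= 1.
Proof.
rewrite /normal_peak sqr_sqrtr ?invr_ge0 // invf_le1; last first.
  by rewrite sqrtr_gt0 pmulrn_lgt0 // mulr_gt0 ?pi_gt0 ?invr_gt0.
rewrite -mulr_natr mulrAC mulVf ?mul1r // -[X in X <= _]sqrtr1 ler_wsqrtr //.
by have := @pi_ge2 R; lra.
Qed.

Lemma sg_neq0 : sg != 0.
Proof. by rewrite gt_eqF // sqrtr_gt0 invr_gt0. Qed.

Lemma measurable_normal_itv (c w : R) :
  measurable_fun `[c, c + w] (EFin \o normal_pdf 0 sg).
Proof.
by apply/measurable_EFinP; apply: measurable_funTS; exact: measurable_normal_pdf.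
Qed.

Lemma normal_prob_itv_le (c w : R) : 0 <= w ->
  fine (normal_prob 0 sg `[c, (c + w)%R]%classic) <= w.
Proof.
move=> w0; have : (normal_prob 0 sg `[c, (c + w)%R]%classic <= w%:E)%E.
  apply: le_trans (_ : (\int[lebesgue_measure]_(x in `[c, (c + w)%R]) 1 <= _)%E).
    apply: ge0_le_integral => //.
    - by move=> x _; rewrite lee_fin normal_pdf_ge0.
    - exact: measurable_normal_itv.
    - by move=> x _; rewrite lee_fin (le_trans (normal_pdf_ub _ _ sg_neq0)) // normal_peak_le1.
  rewrite integral_cst //= mul1e lebesgue_measure_itv /= lte_fin.
  case: ifP => _; last by rewrite lee_fin.
  by rewrite -EFinD addrAC subrr add0r.
have : (0 <= normal_prob 0 sg `[c, (c + w)%R]%classic)%E.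
  by apply: integral_ge0 => x _; rewrite lee_fin normal_pdf_ge0.
by case: (normal_prob _ _ _).
Qed.

Lemma normal_prob_itv_ge (B : R) : exists2 kap : R, 0 < kap &
  forall c w, `|c| <= B -> 0 <= w <= 1 ->
  kap * w <= fine (normal_prob 0 sg `[c, (c + w)%R]%classic).
Proof.
(* The density at [x] is the peak times [exp (- x^2)], and [|x| <= B + 1] on the interval. *)
pose kap : R := normal_peak sg * expR (- (B + 1) ^+ 2).
have pk0 : 0 < normal_peak sg by rewrite normal_peak_gt0 ?sg_neq0.
have kap0 : 0 < kap by rewrite mulr_gt0 // expR_gt0.
exists kap => // c w cB /andP[w0 w1].
have key (y : R) : c <= y -> y <= c + w -> y ^+ 2 <= (B + 1) ^+ 2.
  move: cB; rewrite ler_norml => /andP[h1 h2] h3 h4.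
  by rewrite -subr_ge0 subr_sqr mulr_ge0 //; lra.
have : ((kap * w)%R%:E <= normal_prob 0 sg `[c, (c + w)%R]%classic)%E.
  apply: le_trans (_ : _ <= \int[lebesgue_measure]_(x in `[c, (c + w)%R]) kap%:E)%E _.
    rewrite integral_cst //= lebesgue_measure_itv /= lte_fin ltrDl.
    case: ltP => [_|w0']; first by rewrite -EFinD addrAC subrr add0r -EFinM.
    by rewrite mule0 lee_fin mulr_ge0_le0 // ltW.
  apply: ge0_le_integral => //.
  - by move=> x _; rewrite lee_fin ltW.
  - exact: measurable_normal_itv.
  - move=> /= x; rewrite in_itv /= => /andP[h1 h2].
    rewrite lee_fin normal_pdfE ?sg_neq0 // /normal_fun /kap.
    rewrite ler_wpM2l ?(ltW pk0) // ler_expR subr0 sqr_sqrtr ?invr_ge0 //.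
    rewrite -mulr_natr mulVf // invr1 mulr1 lerN2.
    exact: key.
have := normal_prob_itv_le c w w0.
have : (normal_prob 0 sg `[c, (c + w)%R]%classic < +oo)%E.
  apply: le_lt_trans (_ : normal_prob 0 sg setT < +oo)%E.
    by apply: (@le_measure _ _ _ (normal_prob 0 sg)); rewrite ?inE.
  by rewrite /normal_prob integral_normal_pdf ?sg_neq0 // ltry.
by case: (normal_prob _ _ _).
Qed.

End NormalLaw.

(** * Measurability of complex functions and determinants *)

Section ComplexMeasurable.
Context {d : measure_display} {T : measurableType d} {R : realType}.
Local Notation C := R[i].

Lemma measurable_fun_inv (f : T -> R) :
  measurable_fun setT f -> measurable_fun setT (fun t => (f t)^-1).
Proof.
move=> mf; have -> : (fun t => (f t)^-1) = (fun t => f t * (f t ^+ 2) `^ (- 1)).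
  apply/funext => t; rewrite powR_inv1 ?sqr_ge0 //.
  have [->|f0] := eqVneq (f t) 0; first by rewrite mul0r invr0.
  by field.
apply: measurable_funM => //.
apply: (@measurableT_comp _ _ _ _ _ _ (fun x : R => x `^ (- 1))) => //.
exact: measurable_funX.
Qed.

(** Stated over an arbitrary measurable space, to be used both on [T] and on the sigma-algebra
    generated by the variables in [S]. *)
Definition cfun (f : T -> C) : Prop :=
  measurable_fun setT (fun t => complex.Re (f t)) /\
  measurable_fun setT (fun t => complex.Im (f t)).

Lemma cfun_cst c : cfun (fun=> c).
Proof. by split; exact: measurable_cst. Qed.

Lemma cfunD f g : cfun f -> cfun g -> cfun (fun t => f t + g t).
Proof.
move=> [f1 f2] [g1 g2]; split; under eq_fun do rewrite raddfD /=;
exact: measurable_funD.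
Qed.

Lemma cfunM f g : cfun f -> cfun g -> cfun (fun t => f t * g t).
Proof.
move=> [f1 f2] [g1 g2].
have E (x y : C) : x * y =
  ((complex.Re x * complex.Re y - complex.Im x * complex.Im y)
   +i* (complex.Re x * complex.Im y + complex.Im x * complex.Re y))%C by case: x y => [a b] [c e].
split; under eq_fun do rewrite E /=.
  by apply: measurable_funB; exact: measurable_funM.
by apply: measurable_funD; exact: measurable_funM.
Qed.

Lemma cfunJ f : cfun f -> cfun (fun t => conjc (f t)).
Proof.
move=> [f1 f2]; have E (x : C) : conjc x = (complex.Re x -i* complex.Im x)%C by case: x.
split; under eq_fun do rewrite E /=; first exact: f1.
exact: measurable_funN.
Qed.

Lemma cfun_n2 f : cfun f -> measurable_fun setT (fun t => n2 (f t)).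
Proof. by move=> [f1 f2]; apply: measurable_funD; exact: measurable_funX. Qed.

Lemma cfunV f : cfun f -> cfun (fun t => (f t)^-1).
Proof.
move=> cf; have E (x : C) : x^-1 = conjc x * ((n2 x)^-1)%:C%C.
  rewrite invc_norm -exprVn exprVn n2E mulrC; congr (_ * _).
  by rewrite fmorphV.
have -> : (fun t => (f t)^-1) = (fun t => conjc (f t) * ((n2 (f t))^-1)%:C%C).
  by apply/funext => t; exact: E.
apply: cfunM; first exact: cfunJ.
split => /=; last exact: measurable_cst.
by apply: measurable_fun_inv; exact: cfun_n2.
Qed.

Lemma cfun_sum (J : Type) (s : seq J) (F : J -> T -> C) :
  (forall j, cfun (F j)) -> cfun (fun t => \sum_(j <- s) F j t).
Proof.
move=> cF; elim: s => [|j s IH].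
  by under eq_fun do rewrite big_nil; exact: cfun_cst.
by under eq_fun do rewrite big_cons; exact: cfunD.
Qed.

Lemma cfun_prod (J : Type) (s : seq J) (F : J -> T -> C) :
  (forall j, cfun (F j)) -> cfun (fun t => \prod_(j <- s) F j t).
Proof.
move=> cF; elim: s => [|j s IH].
  by under eq_fun do rewrite big_nil; exact: cfun_cst.
by under eq_fun do rewrite big_cons; exact: cfunM.
Qed.

Lemma cfun_det n (A : T -> 'M[C]_n) :
  (forall i j, cfun (fun t => A t i j)) -> cfun (fun t => \det (A t)).
Proof.
move=> cA; rewrite /determinant; apply: cfun_sum => s.
by apply: cfunM; [exact: cfun_cst|apply: cfun_prod => i; exact: cA].
Qed.

Lemma measurable_gdet m n rho (H : T -> 'M[C]_(m, n)) :
  (forall i j, cfun (fun t => H t i j)) ->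
  measurable_fun setT (fun t => gdet rho (H t)).
Proof.
move=> cH; have [] // : cfun (fun t =>
  \det (1%:M + (rho%:C)%C *: (H t *m herm (H t)))).
apply: cfun_det => i j; under eq_fun do rewrite mxE [X in _ + X]mxE.
apply: cfunD; first exact: cfun_cst.
apply: cfunM; first exact: cfun_cst.
under eq_fun do rewrite mxE; apply: cfun_sum => k; apply: cfunM; first exact: cH.
by under eq_fun do rewrite !mxE; apply: cfunJ; exact: cH.
Qed.

End ComplexMeasurable.
(** * The diversity-multiplexing trade-off *)

Section LevelBound.
Context {R : realType}.

Lemma powR_ge1 (x y : R) : 1 <= x -> 0 <= y -> 1 <= x `^ y.
Proof. by move=> x1 y0; rewrite -(powRr0 x) ler_powR. Qed.

Lemma powRDp (x y z : R) : 1 <= x -> x `^ (y + z) = x `^ y * x `^ z.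
Proof. move=> x1; have x0 : x != 0 by rewrite gt_eqF // (lt_le_trans ltr01 x1).
by rewrite powRD // x0 implybT. Qed.

(* Thresholds for the squared modulus of a pivot; below the last one, level [L],
   only the trivial lower bound [0] is used. *)
Definition level (rho : R) (L l : nat) : R := rho `^ (- (l%:R / L%:R)).

Definition level_lo (rho : R) (L l : nat) : R :=
  if l == L.+1 then 0 else level rho L l.

(** The first factor bounds the probability of level [l], the second is its gain in the Chernoff
    estimate. With [x = (l - 1) / L] the exponents add up to [- x w - (1 - x) lam + lam / L], and a
    convex combination of [w] and [lam] is at least their minimum. The term [lam / L] pays for
    bounding the pivot by different levels from above and below. At the two extreme levels one
    factor is just bounded by 1. *)
Lemma level_bound (rho lam : R) (w L l : nat) : 1 <= rho -> 0 <= lam ->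
  (0 < L)%N -> (l <= L.+1)%N ->
  (if l is l'.+1 then 9 ^+ w * level rho L l' ^+ w else 1) *
    ((1 + rho * level_lo rho L l)^-1) `^ lam <=
  9 ^+ w * rho `^ (- Num.min lam w%:R + lam / L%:R).
Proof.
move=> rho1 lam0 L0 lL.
have rho0 : 0 < rho by exact: lt_le_trans ltr01 rho1.
have Lr0 : 0 < L%:R :> R by rewrite ltr0n.
have n9 : 1 <= 9 ^+ w :> R by rewrite exprn_ege1 // ler1n.
have lv0 j : 0 < level rho L j by rewrite powR_gt0.
set mu := Num.min lam w%:R.
have mul : mu <= lam by rewrite ge_min lexx.
have muw : mu <= w%:R by rewrite ge_min lexx orbT.
have lamL0 : 0 <= lam / L%:R by rewrite divr_ge0 // ltW.
have lo0 : 0 <= level_lo rho L l by rewrite /level_lo; case: ifP => // _; exact: ltW.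
have low : ((1 + rho * level_lo rho L l)^-1) `^ lam <= 1.
  apply: (@le_trans _ _ (1 `^ lam)); last by rewrite powR1.
  rewrite ge0_ler_powR // ?nnegrE ?invr_ge0 ?addr_ge0 ?mulr_ge0 ?(ltW rho0) //.
  by rewrite invf_le1 ?lerDl ?mulr_ge0 ?(ltW rho0) // ltr_pwDl // mulr_ge0 // ltW.
have lowL : (l <= L)%N -> ((1 + rho * level_lo rho L l)^-1) `^ lam <=
    rho `^ (- ((1 - l%:R / L%:R) * lam)).
  move=> lL'; rewrite -mulNr powRrM powRN.
  have e0 : 0 < rho * level_lo rho L l by rewrite mulr_gt0 // /level_lo ltn_eqF.
  rewrite ge0_ler_powR // ?nnegrE ?invr_ge0 ?powR_ge0 ?addr_ge0 ?(ltW e0) //.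
  rewrite lef_pV2 ?posrE ?powR_gt0 //; last by rewrite addr_gt0.
  rewrite /level_lo ltn_eqF // powRDp // powRr1 ?(ltW rho0) // lerDr //.
have lvX j : level rho L j ^+ w = rho `^ (- (j%:R / L%:R * w%:R)).
  by rewrite -powR_mulrn ?(ltW (lv0 j)) // -powRrM mulNr.
case: l lL lo0 low lowL => [|l] lL lo0 low lowL.
  rewrite mul1r; apply: le_trans (lowL _) _ => //.
  rewrite mul0r subr0 mul1r -[X in X <= _]mul1r ler_pM ?powR_ge0 //.
  by apply: ler_powR => //; lra.
rewrite -mulrA ler_wpM2l ?(le_trans ler01) // lvX.
have [lL'|] := leqP l.+1 L.
  apply: le_trans (ler_wpM2l (powR_ge0 _ _) (lowL lL')) _.
  rewrite -powRDp //; apply: ler_powR => //.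
  have x0 : 0 <= l%:R / L%:R :> R by rewrite divr_ge0.
  have x1 : l%:R / L%:R <= 1 :> R by rewrite ler_pdivrMr // mul1r ler_nat ltnW.
  rewrite -natr1 (mulrDl l%:R) mul1r.
  set x := l%:R / L%:R in x0 x1 *; clearbody x; move: (L%:R^-1) => y.
  have h1 : 0 <= x * (w%:R - mu) by rewrite mulr_ge0 // subr_ge0.
  have h2 : 0 <= (1 - x) * (lam - mu) by rewrite mulr_ge0 // subr_ge0.
  nra.
move=> Ll; have lE : l = L by apply/eqP; rewrite eqn_leq -ltnS lL -ltnS.
rewrite {}lE in low *.
rewrite divff ?gt_eqF // mul1r -[X in _ <= X]mulr1 ler_pM ?powR_ge0 //.
by apply: ler_powR => //; lra.
Qed.

End LevelBound.

(** * Shifted Gaussian matrices and their Schur complements *)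

Section Channel.
Context {d : measure_display} {T : measurableType d} {R : realType}.
Context (P : probability T R) {I : finType} (X : I -> T -> R).
Hypothesis mX : forall i, measurable_fun setT (X i).
Hypothesis indep : mutually_independent P X.
Local Notation C := R[i].
Local Notation sg := (Num.sqrt (2^-1) : R).
Local Notation Pr := (Pr P).
Implicit Type S : {set I}.

(* An [m x n] matrix of fresh Gaussian variables shifted by functions of the
   variables of [S]; Schur complements of such matrices are again of this form,
   for a larger [S]. *)
Definition shifted {m n} S (idx : 'I_m * 'I_n * bool -> I)
    (Y : 'I_m * 'I_n * bool -> T -> R) : Prop :=
  [/\ injective idx, forall x, idx x \notin S,
      forall x B, measurable B -> P (X (idx x) @^-1` B) = normal_prob 0 sg B &
      forall x, sfun X S (Y x)].

Definition entry {m n} (idx : 'I_m * 'I_n * bool -> I)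
    (Y : 'I_m * 'I_n * bool -> T -> R) x t : R := X (idx x) t + Y x t.

Definition hmat {m n} (idx : 'I_m * 'I_n * bool -> I)
    (Y : 'I_m * 'I_n * bool -> T -> R) (t : T) : 'M[C]_(m, n) :=
  \matrix_(p, q) (entry idx Y (p, q, true) t +i* entry idx Y (p, q, false) t)%C.

(** The column is listed through [lift i0], so that the pivot is not listed twice and there are
    exactly [2 (m + n + 1)] real coordinates. *)
Definition cross {m n} (i0 : 'I_m.+1) (j0 : 'I_n.+1) : seq ('I_m.+1 * 'I_n.+1 * bool) :=
  [seq (i0, q, b) | q <- enum 'I_n.+1, b <- [:: true; false]] ++
  [seq (lift i0 p, j0, b) | p <- enum 'I_m, b <- [:: true; false]].

Lemma size_cross {m n} (i0 : 'I_m.+1) (j0 : 'I_n.+1) :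
  size (cross i0 j0) = (2 * (m + n).+1)%N.
Proof.
rewrite size_cat !size_allpairs /= !size_enum_ord.
by rewrite -mulnDl mulnC addSn addnC.
Qed.

Lemma mem_cross {m n} (i0 : 'I_m.+1) (j0 : 'I_n.+1) p q b :
  ((p, q, b) \in cross i0 j0) = (p == i0) || (q == j0).
Proof.
have mb : b \in [:: true; false] by case: b.
rewrite mem_cat; apply/idP/idP => [/orP[]|].
- by case/allpairsP => -[q' b'] /= [_ _ [-> _ _]]; rewrite eqxx.
- by case/allpairsP => -[q' b'] /= [_ _ [_ -> _]]; rewrite eqxx orbT.
case: (unliftP i0 p) => [p' ->|->] h.
  move: h; rewrite eq_sym (negbTE (neq_lift _ _)) orFb => /eqP ->.
  apply/orP; right; apply/allpairsP; exists (p', b); split => //=.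
  by rewrite mem_enum.
apply/orP; left; apply/allpairsP; exists (q, b); split => //=.
by rewrite mem_enum.
Qed.

Lemma uniq_cross {m n} (i0 : 'I_m.+1) (j0 : 'I_n.+1) : uniq (cross i0 j0).
Proof.
rewrite cat_uniq; apply/and3P; split.
- apply: allpairs_uniq; rewrite ?enum_uniq //.
  by move=> [q b] [q' b'] _ _ /= [-> ->].
- apply/hasPn => x /allpairsP[[p b] [_ _ ->]].
  apply/negP => /allpairsP[[q' b'] [_ _ [e _ _]]].
  by have := neq_lift i0 p; rewrite e eqxx.
- apply: allpairs_uniq; rewrite ?enum_uniq //.
  move=> [q b] [q' b'] _ _ /= e.
  by move: (congr1 (fun x => x.1.1) e) (congr1 snd e) => /= /lift_inj -> ->.
Qed.

Definition sub_idx {m n} (i0 : 'I_m.+1) (j0 : 'I_n.+1) (x : 'I_m * 'I_n * bool) :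
  'I_m.+1 * 'I_n.+1 * bool := (lift i0 x.1.1, lift j0 x.1.2, x.2).

Definition elim_term {m n} (i0 : 'I_m.+1) (j0 : 'I_n.+1) (H : 'M[C]_(m.+1, n.+1))
    (x : 'I_m * 'I_n * bool) : R :=
  let z := H (lift i0 x.1.1) j0 * H i0 (lift j0 x.1.2) / H i0 j0 in
  if x.2 then complex.Re z else complex.Im z.

Definition next_set {m n} S (idx : 'I_m.+1 * 'I_n.+1 * bool -> I)
  (i0 : 'I_m.+1) (j0 : 'I_n.+1) := S :|: [set i in map idx (cross i0 j0)].

Definition next_shift {m n} (idx : 'I_m.+1 * 'I_n.+1 * bool -> I) Y
    (i0 : 'I_m.+1) (j0 : 'I_n.+1) (x : 'I_m * 'I_n * bool) (t : T) : R :=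
  Y (sub_idx i0 j0 x) t - elim_term i0 j0 (hmat idx Y t) x.

Lemma schur_hmat {m n} idx Y (i0 : 'I_m.+1) (j0 : 'I_n.+1) t :
  hmat (idx \o sub_idx i0 j0) (next_shift idx Y i0 j0) t = schur i0 j0 (hmat idx Y t).
Proof.
apply/matrixP => p q; rewrite mxE [RHS]mxE /entry /next_shift /elim_term /=.
set z := _ / _; rewrite [hmat idx Y t (lift i0 p) _]mxE /entry /sub_idx /=.
by case: z => a b; simpc; rewrite !addrA.
Qed.

Lemma sfun_entry {m n} S (idx : 'I_m * 'I_n * bool -> I) Y x :
  idx x \in S -> sfun X S (Y x) -> sfun X S (entry idx Y x).
Proof. by move=> xS sY; apply: measurable_funD => //; exact: sfun_var. Qed.

Lemma cfun_hmat {m n} S (idx : 'I_m * 'I_n * bool -> I) Y p q :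
  (forall b, idx (p, q, b) \in S) -> (forall b, sfun X S (Y (p, q, b))) ->
  @cfun _ (g_sigma_algebraType (gens X S)) _ (fun t => hmat idx Y t p q).
Proof.
move=> pS sY; split; under eq_fun do rewrite mxE /=; exact: sfun_entry.
Qed.

(** Off the cross each entry keeps its own Gaussian variable; only its shift changes, by a rational
    function of the cross, whose variables have joined [S]. *)
Lemma shifted_next {m n} S idx Y (i0 : 'I_m.+1) (j0 : 'I_n.+1) :
  shifted S idx Y ->
  shifted (next_set S idx i0 j0) (idx \o sub_idx i0 j0) (next_shift idx Y i0 j0).
Proof.
move=> [inj nS law sY]; have subS : S \subset next_set S idx i0 j0 by exact: finset.subsetUl.
split.
- move=> [[p q] b] [[p' q'] b'] /= /inj e.
  move: (congr1 (fun x => x.1.1) e) (congr1 (fun x => x.1.2) e) (congr1 snd e).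
  by move=> /= /lift_inj -> /lift_inj -> ->.
- move=> [[p q] b]; rewrite !inE negb_or nS /= mem_map // mem_cross.
  by rewrite negb_or ![lift _ _ == _]eq_sym !neq_lift.
- by move=> x B mB; exact: law.
- move=> [[p q] b].
  have c x y : (x == i0) || (y == j0) ->
      @cfun _ (g_sigma_algebraType (gens X (next_set S idx i0 j0))) _
        (fun t => hmat idx Y t x y).
    move=> xy; apply: cfun_hmat => b'; last exact: sfunS (sY _).
    by rewrite !inE mem_map // mem_cross xy orbT.
  have [z1 z2] : @cfun _ (g_sigma_algebraType (gens X (next_set S idx i0 j0))) _
      (fun t => hmat idx Y t (lift i0 p) j0 * hmat idx Y t i0 (lift j0 q) / hmat idx Y t i0 j0).
    by apply: cfunM; [apply: cfunM|apply: cfunV]; apply: c; rewrite eqxx ?orbT.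
  apply: measurable_funB; first exact: sfunS (sY _).
  by case: b.
Qed.

Lemma measurable_hmat {m n} S idx Y (p : 'I_m) (q : 'I_n) : shifted S idx Y ->
  cfun (fun t => hmat idx Y t p q).
Proof.
move=> [_ _ _ sY]; split; under eq_fun do rewrite mxE /=;
by apply: measurable_funD => //; exact: (measurable_sfun X mX S).
Qed.

Lemma measurable_gdet_le {m n} S idx (Y : 'I_m * 'I_n * bool -> T -> R) rho s :
  shifted S idx Y -> measurable [set t | gdet rho (hmat idx Y t) <= s].
Proof.
move=> sh; rewrite -[X in measurable X]setTI.
apply: measurable_fun_le => //; apply: measurable_gdet => p q.
exact: measurable_hmat sh.
Qed.

End Channel.

(** * Upper bound on the probability of a small determinant *)

Section OutageUpper.
Context {d : measure_display} {T : measurableType d} {R : realType}.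
Context (P : probability T R) {I : finType} (X : I -> T -> R).
Hypothesis mX : forall i, measurable_fun setT (X i).
Hypothesis indep : mutually_independent P X.
Implicit Type S : {set I}.

Fixpoint gexp (lam : R) (m n : nat) : R :=
  match m, n with
  | m'.+1, n'.+1 => Num.min lam (m' + n').+1%:R + gexp lam m' n'
  | _, _ => 0
  end.

Definition tail_bound (m n : nat) (lam mu C : R) : Prop :=
  forall (rho s : R) S (idx : 'I_m * 'I_n * bool -> I) Y A,
  1 <= rho -> 0 < s -> shifted P X S idx Y -> smeas X S A ->
  Pr P (A `&` [set t | gdet rho (hmat X idx Y t) <= s]) <=
  C * s `^ lam * rho `^ mu * Pr P A.

Lemma tail_bound0 m n lam mu : 0 <= lam -> 0 <= mu ->
  (forall rho (H : 'M[R[i]]_(m, n)), gdet rho H = 1) -> tail_bound m n lam mu 1.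
Proof.
move=> lam0 mu0 H1 rho s S idx Y A rho1 s0 sh sA; rewrite mul1r.
have mA := smeas_measurable X mX S _ sA.
have pA := Pr_ge0 P A.
have [s1|s1] := leP 1 s.
  apply: (@le_trans _ _ (Pr P A)).
    have mE := measurable_gdet_le P X mX S idx Y rho s sh.
    by apply: Pr_le => //; exact: measurableI.
  by rewrite ler_peMl // mulr_ege1 // powR_ge1.
have -> : A `&` [set t | gdet rho (hmat X idx Y t) <= s] = set0.
  by apply/seteqP; split => // t [_ /=]; rewrite H1 leNgt s1.
by rewrite /Pr measure0 !mulr_ge0 ?powR_ge0.
Qed.

(** A pivot of squared modulus at least [tau] turns [det <= s] into the bound
    [s' = c s / (1 + rho tau)] on the determinant of the Schur complement; the power [lam] of [s']
    carries the gain. *)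
Lemma tail_bound_pivot m n lam mu C0 c rho tau s S
    (idx : 'I_m.+1 * 'I_n.+1 * bool -> I) Y i0 j0 A :
  tail_bound m n lam mu C0 -> 0 <= lam -> 0 <= C0 -> 1 <= c ->
  (forall rho (H : 'M[R[i]]_(m.+1, n.+1)), 0 < rho ->
    (forall p, n2 (H p j0) <= 4 * n2 (H i0 j0)) ->
    (forall q, n2 (H i0 q) <= 4 * n2 (H i0 j0)) ->
    (1 + rho * n2 (H i0 j0)) * gdet rho (schur i0 j0 H) <= gdet rho H * c) ->
  1 <= rho -> 0 <= tau -> 0 < s -> shifted P X S idx Y ->
  smeas X (next_set S idx i0 j0) A ->
  (forall t, A t -> tau <= n2 (hmat X idx Y t i0 j0)) ->
  (forall t x, A t -> x \in cross i0 j0 ->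
     n2 (hmat X idx Y t x.1.1 x.1.2) <= n2 (hmat X idx Y t i0 j0)) ->
  Pr P (A `&` [set t | gdet rho (hmat X idx Y t) <= s]) <=
  C0 * c `^ lam * s `^ lam * ((1 + rho * tau)^-1) `^ lam * rho `^ mu * Pr P A.
Proof.
move=> tb lam0 C00 c1 Hc rho1 tau0 s0 sh sA Atau Across.
have rho0 : 0 < rho := lt_le_trans ltr01 rho1.
have c0 : 0 < c := lt_le_trans ltr01 c1.
have sh' := shifted_next P X S idx Y i0 j0 sh.
have mA := smeas_measurable X mX _ _ sA.
have t0 : 0 < 1 + rho * tau by rewrite ltr_pwDl // mulr_ge0 // ltW.
pose s' := c * s * (1 + rho * tau)^-1.
have s'0 : 0 < s' by rewrite !mulr_gt0 // invr_gt0.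
apply: (@le_trans _ _ (Pr P (A `&` [set t |
    gdet rho (hmat X (idx \o sub_idx i0 j0) (next_shift X idx Y i0 j0) t) <= s']))).
  apply: Pr_le; [| |move=> t [At /= hs]].
  - by apply: measurableI => //; exact: measurable_gdet_le sh.
  - by apply: measurableI => //; exact: measurable_gdet_le sh'.
  split => //=; rewrite schur_hmat /s' ler_pdivlMr // mulrC.
  have H4 x : x \in cross i0 j0 ->
      n2 (hmat X idx Y t x.1.1 x.1.2) <= 4 * n2 (hmat X idx Y t i0 j0).
    move=> xc; apply: le_trans (Across t x At xc) _.
    by rewrite ler_peMl ?n2_ge0 // ler1n.
  apply: le_trans (_ : gdet rho (hmat X idx Y t) * c <= _); last first.
    by rewrite mulrC ler_wpM2l // ltW.
  apply: le_trans (Hc rho (hmat X idx Y t) rho0 _ _).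
  - rewrite ler_wpM2r ?(le_trans ler01) ?gdet_ge1 ?(ltW rho0) //.
    by rewrite lerD2l ler_wpM2l ?(ltW rho0) // Atau.
  - by move=> p; apply: (H4 (p, j0, true)); rewrite mem_cross eqxx orbT.
  - by move=> q; apply: (H4 (i0, q, true)); rewrite mem_cross eqxx.
apply: le_trans (tb rho s' _ _ _ _ rho1 s'0 sh' sA) _.
rewrite /s' !powRM ?invr_ge0 ?mulr_ge0 ?(ltW c0) ?(ltW s0) ?(ltW t0) //.
by rewrite !mulrA.
Qed.

(** Dominance is required over the cross only: the event then lies in the sigma-algebra of
    [next_set] and the other variables stay fresh. The upper bound on the pivot is recorded for all
    real coordinates of the cross, since it is their joint smallness that has a small probability.
    Level 0 has no upper bound. *)
Definition level_event {m n} (idx : 'I_m.+1 * 'I_n.+1 * bool -> I) Y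
    (rho : R) (L : nat) i0 j0 (l : nat) : set T :=
  [set t | forall x, x \in cross i0 j0 ->
     n2 (hmat X idx Y t x.1.1 x.1.2) <= n2 (hmat X idx Y t i0 j0)] `&`
  ([set t | level_lo rho L l <= n2 (hmat X idx Y t i0 j0)] `&`
   [set t | forall x, x \in (if l is 0%N then [::] else cross i0 j0) ->
     `|entry X idx Y x t| <= Num.sqrt (level rho L l.-1)]).

Lemma smeas_level m n S (idx : 'I_m.+1 * 'I_n.+1 * bool -> I) Y rho L i0 j0 l A :
  shifted P X S idx Y -> smeas X S A ->
  smeas X (next_set S idx i0 j0) (A `&` level_event idx Y rho L i0 j0 l).
Proof.
move=> [inj nS law sY] sA; set S' := next_set S idx i0 j0.
have SS' : S \subset S' by exact: finset.subsetUl.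
have inS' x : x \in cross i0 j0 -> idx x \in S' by move=> xc; rewrite !inE map_f ?orbT.
have mn2 x y : (x == i0) || (y == j0) ->
    @measurable_fun _ _ (g_sigma_algebraType (gens X S')) R setT
      (fun t => n2 (hmat X idx Y t x y)).
  move=> xy; apply: cfun_n2; apply: cfun_hmat => b; last exact: sfunS (sY _).
  by apply: inS'; rewrite mem_cross.
have ma := mn2 i0 j0; rewrite eqxx in ma.
have sA' : smeas X S' A by exact: smeasS sA.
have := smeas_all X S' _ (cross i0 j0)
  (fun x => [set t | n2 (hmat X idx Y t x.1.1 x.1.2) <= n2 (hmat X idx Y t i0 j0)]) sA'.
move=> h1; apply: (_ : smeas X S' (_ `&` (_ `&` _))); rewrite setIA; apply: smeasI.
  apply: h1 => -[[x y] b] xc; rewrite -[X in smeas _ _ X]setTI.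
  apply: (@measurable_fun_le _ (g_sigma_algebraType (gens X S'))) => //; last exact: ma.
  by apply: mn2; rewrite mem_cross in xc.
rewrite -[[set t | _ <= _]]setTI; apply: smeas_all; rewrite ?setTI.
  rewrite -[X in smeas _ _ X]setTI.
  by apply: (@measurable_fun_le _ (g_sigma_algebraType (gens X S'))) => //; exact: ma.
case: l => // l x xc; apply: smeas_le; first exact: inS'.
exact: sfunS (sY _).
Qed.

Lemma Pr_level m n S (idx : 'I_m.+1 * 'I_n.+1 * bool -> I) Y rho L i0 j0 l A :
  1 <= rho -> shifted P X S idx Y -> smeas X S A ->
  Pr P (A `&` level_event idx Y rho L i0 j0 l) <=
  (if l is l'.+1 then 9 ^+ (m + n).+1 * level rho L l' ^+ (m + n).+1 else 1) * Pr P A.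
Proof.
move=> rho1 sh sA; have [inj nS law sY] := sh.
have mA := smeas_measurable X mX S _ sA.
have mAl := smeas_measurable X mX _ _ (smeas_level m n S idx Y rho L i0 j0 l A sh sA).
case: l mAl => [|l] mAl; first by rewrite mul1r; apply: Pr_le => // t [].
have lv0 : 0 < level rho L l by rewrite powR_gt0 // (lt_le_trans ltr01).
set del := Num.sqrt (level rho L l).
have del0 : 0 < del by rewrite sqrtr_gt0.
(* Each of the [2 (m + n + 1)] real coordinates contributes [3 del], where [del^2] is the level;
   hence the base [9 = 3^2]. *)
have -> : 9 ^+ (m + n).+1 * level rho L l ^+ (m + n).+1 =
    (3 * del) ^+ size (cross i0 j0).
  rewrite size_cross exprM -exprMn; congr (_ ^+ _).
  by rewrite exprMn sqr_sqrtr ?(ltW lv0) // -natrX.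
have hx x : x \in cross i0 j0 -> idx x \in next_set S idx i0 j0.
  by move=> xc; rewrite !inE map_f ?orbT.
apply: le_trans (_ : Pr P (A `&` [set t | forall x, x \in cross i0 j0 ->
    `|X (idx x) t + Y x t| <= del]) <= _).
  apply: Pr_le => //; last by move=> t [At [_ [_ h]]]; split => // x xc; exact: h.
  apply: (smeas_measurable X mX (next_set S idx i0 j0)).
  apply: (smeas_all X _ _ _ (fun x => [set t | `|X (idx x) t + Y x t| <= del])).
    by apply: smeasS sA; exact: finset.subsetUl.
  move=> x xc; apply: smeas_le; first exact: hx.
  by apply: sfunS (sY _); exact: finset.subsetUl.
apply: (steps_le P X mX indep idx Y S) => //.
- by rewrite mulr_ge0 // ltW.
- by rewrite map_inj_uniq // uniq_cross.
- move=> x c _; rewrite /Pr law //; apply: normal_prob_itv_le.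
  by rewrite mulr_ge0 // ltW.
Qed.

(** Take a largest entry as pivot and the least [l] whose lower threshold it reaches; by minimality
    it is below the threshold of [l - 1], and so is everything that it dominates. *)
Lemma level_cover m n (idx : 'I_m.+1 * 'I_n.+1 * bool -> I) Y rho L t :
  1 <= rho -> (0 < L)%N ->
  exists j : 'I_m.+1 * 'I_n.+1 * 'I_L.+2,
    level_event idx Y rho L j.1.1 j.1.2 j.2 t.
Proof.
move=> rho1 L0; set H := hmat X idx Y t.
have [[i0 j0] _ /= hmax] := arg_maxP (fun x : 'I_m.+1 * 'I_n.+1 => n2 (H x.1 x.2))
  (erefl : xpredT (ord0, ord0)).
have hcr x : n2 (H x.1.1 x.1.2) <= n2 (H i0 j0) by exact: (hmax (x.1.1, x.1.2)).
have ex : exists l, level_lo rho L l <= n2 (H i0 j0).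
  by exists L.+1; rewrite /level_lo eqxx n2_ge0.
have [l hl lmin] := ex_minnP ex.
have lL : (l < L.+2)%N.
  by rewrite ltnS; apply: lmin; rewrite /level_lo eqxx n2_ge0.
exists (i0, j0, Ordinal lL) => /=; split; [by move=> x _; exact: hcr|split => //=].
case: l hl lmin lL => // l hl lmin lL x xc.
have : ~~ (level_lo rho L l <= n2 (H i0 j0)).
  by apply/negP => /lmin; rewrite ltnn.
rewrite -ltNge /level_lo ltn_eqF // => h.
rewrite -sqrtr_sqr ler_wsqrtr // (le_trans _ (ltW h)) //.
apply: le_trans _ (hcr _ x); case: x xc => [[p q] b] _ /=.
by rewrite mxE /n2 /=; case: b; rewrite ?lerDl ?lerDr sqr_ge0.
Qed.

Theorem gdet_tail m n lam eps : 0 <= lam -> 0 < eps ->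
  exists2 C, 0 < C & tail_bound m n lam (- gexp lam m n + eps) C.
Proof.
elim: m n eps => [|m IH] n eps lam0 eps0.
  exists 1 => //; rewrite /= oppr0 add0r; apply: tail_bound0 => //; first exact: ltW.
  by move=> *; exact: gdet_row0.
case: n => [|n].
  exists 1 => //; rewrite /= oppr0 add0r; apply: tail_bound0 => //; first exact: ltW.
  by move=> *; exact: gdet_col0.
have e20 : 0 < eps / 2 by rewrite divr_gt0.
have [C0 C00 tb] := IH n _ lam0 e20.
have [c c1 Hc] := @gdet_schur R m n.
(* Half of [eps] pays for the grid, the other half for the induction. *)
have [L L0 lamL] : exists2 L, (0 < L)%N & lam / L%:R <= eps / 2.
  exists (Num.truncn (lam / (eps / 2))).+1 => //.
  rewrite ler_pdivrMr ?ltr0n // mulrC -ler_pdivrMr //.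
  by apply: ltW; apply: truncnS_gt.
have c0 : 0 < c := lt_le_trans ltr01 c1.
set w := (m + n).+1.
pose K := C0 * c `^ lam * 9 ^+ w.
have K0 : 0 < K by rewrite !mulr_gt0 ?powR_gt0 // exprn_gt0.
(* The number of pairs of a pivot position and a level, for the union bound. *)
pose N : R := \sum_(j : 'I_m.+1 * 'I_n.+1 * 'I_L.+2) 1.
exists (N * K).
  by rewrite mulr_gt0 // /N (bigD1 (ord0, ord0, ord0)) //= ltr_pwDl // sumr_ge0.
move=> rho s S idx Y A rho1 s0 sh sA.
have mA := smeas_measurable X mX S _ sA.
have rho0 : 0 < rho := lt_le_trans ltr01 rho1.
pose F (j : 'I_m.+1 * 'I_n.+1 * 'I_L.+2) :=
  A `&` level_event idx Y rho L j.1.1 j.1.2 j.2 `&`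
  [set t | gdet rho (hmat X idx Y t) <= s].
have mE : measurable [set t | gdet rho (hmat X idx Y t) <= s].
  exact: measurable_gdet_le sh.
have sF j := smeas_level m n S idx Y rho L j.1.1 j.1.2 (j.2 : nat) A sh sA.
have mF (j : 'I_m.+1 * 'I_n.+1 * 'I_L.+2) : measurable (F j).
  apply: measurableI => //.
  exact: (smeas_measurable X mX _ _ (sF (j.1, j.2 : nat))).
apply: le_trans (Pr_cover P _ F _ mF _) _; first exact: measurableI.
  by move=> t [At hs]; have [j hj] := level_cover m n idx Y rho L t rho1 L0; exists j.
set B := K * s `^ lam * rho `^ (- gexp lam m.+1 n.+1 + eps) * Pr P A.
apply: le_trans (_ : \sum_(j : 'I_m.+1 * 'I_n.+1 * 'I_L.+2) B <= _); last first.
  by under eq_bigr do rewrite -[B]mul1r; rewrite -mulr_suml /B !mulrA.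
apply: ler_sum => -[[i0 j0] l] _; rewrite /F /=.
have lo0 : 0 <= level_lo rho L l by rewrite /level_lo; case: ifP => // _; exact: powR_ge0.
apply: le_trans (tail_bound_pivot m n lam _ C0 c rho (level_lo rho L l) s S idx Y i0 j0 _
  tb lam0 (ltW C00) c1 _ rho1 lo0 s0 sh (sF (i0, j0, l : nat)) _ _) _.
- by move=> r H r0 h1 h2; case: (Hc r i0 j0 H r0 h1 h2).
- by move=> t [_ [_ [h _]]].
- by move=> t x [_ [h _]]; exact: h.
apply: le_trans (ler_wpM2l _ (Pr_level m n S idx Y rho L i0 j0 l A rho1 sh sA)) _.
  by rewrite !mulr_ge0 ?powR_ge0 // ltW.
have := level_bound rho lam w L l rho1 lam0 L0 (ltn_ord l).
set lv := (X in is_true (X * _ <= _) -> _); set lo := (1 + _)^-1 `^ lam => hb.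
have -> : C0 * c `^ lam * s `^ lam * lo * rho `^ (- gexp lam m n + eps / 2) * (lv * Pr P A) =
  (lv * lo) * (C0 * c `^ lam * s `^ lam * rho `^ (- gexp lam m n + eps / 2) * Pr P A) by ring.
apply: le_trans (ler_wpM2r _ hb) _.
  by rewrite !mulr_ge0 ?powR_ge0 ?Pr_ge0 // ltW.
have -> : 9 ^+ w * rho `^ (- Num.min lam w%:R + lam / L%:R) *
  (C0 * c `^ lam * s `^ lam * rho `^ (- gexp lam m n + eps / 2) * Pr P A) =
  (K * s `^ lam) * (rho `^ (- Num.min lam w%:R + lam / L%:R) * rho `^ (- gexp lam m n + eps / 2)) * Pr P A.
  by rewrite /K; ring.
rewrite /B ler_wpM2r ?Pr_ge0 // ler_wpM2l //.
  by rewrite mulr_ge0 ?powR_ge0 // ltW.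
rewrite -powRDp //; apply: ler_powR => //.
by rewrite /= -/w; lra.
Qed.

End OutageUpper.

(** * Lower bound on the probability of a small determinant *)

Section OutageLower.
Context {d : measure_display} {T : measurableType d} {R : realType}.
Context (P : probability T R) {I : finType} (X : I -> T -> R).
Hypothesis mX : forall i, measurable_fun setT (X i).
Hypothesis indep : mutually_independent P X.
Implicit Type S : {set I}.

(** [alpha j] prescribes the order [rho^(- alpha j)] of the squared modulus of pivot [j]; [cost] is
    the resulting exponent of the probability, and [gain] below that of the determinant. *)
Fixpoint cost (alpha : nat -> R) (m n : nat) : R :=
  match m, n with
  | m'.+1, n'.+1 => alpha 0%N * (m' + n').+1%:R + cost (fun j => alpha j.+1) m' n'
  | _, _ => 0
  end.

Fixpoint gain (alpha : nat -> R) (m n : nat) : R :=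
  match m, n with
  | m'.+1, n'.+1 => (1 - alpha 0%N) + gain (fun j => alpha j.+1) m' n'
  | _, _ => 0
  end.

Definition small_bound (m n : nat) (alpha : nat -> R) (B K c : R) : Prop :=
  forall (rho : R) S (idx : 'I_m * 'I_n * bool -> I) Y A,
  1 <= rho -> shifted P X S idx Y -> smeas X S A ->
  (forall t x, A t -> `|Y x t| <= B) ->
  c * rho `^ (- cost alpha m n) * Pr P A <=
  Pr P (A `&` [set t | gdet rho (hmat X idx Y t) <= K * rho `^ gain alpha m n]).

Lemma small_bound0 m n alpha B : cost alpha m n = 0 -> gain alpha m n = 0 ->
  (forall rho (H : 'M[R[i]]_(m, n)), gdet rho H = 1) -> small_bound m n alpha B 1 1.
Proof.
move=> c0 g0 H1 rho S idx Y A rho1 sh sA _.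
rewrite c0 g0 oppr0 powRr0 !mul1r (_ : [set t | _] = setT) ?setIT //.
by apply/seteqP; split => // t _ /=; rewrite H1 lexx.
Qed.

Lemma n2M (x y : R[i]) : n2 (x * y) = n2 x * n2 y.
Proof. by apply: (@complexI R); rewrite -n2E normrM exprMn rmorphM /= -!n2E. Qed.

Lemma n2V (x : R[i]) : n2 x^-1 = (n2 x)^-1.
Proof. by apply: (@complexI R); rewrite -n2E normfV exprVn n2E fmorphV. Qed.

(** The real part of the pivot is sent to [[del, 3 del]], every other coordinate of the cross to
    [[- del, del]]: the pivot stays away from 0, and the other cross entries have at most twice its
    squared modulus. *)
Definition corner {m n} (del : R) (x : 'I_m.+1 * 'I_n.+1 * bool) : R :=
  if x == (ord0, ord0, true) then del else - del.

Lemma corner_entries m n (idx : 'I_m.+1 * 'I_n.+1 * bool -> I) Y del t :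
  0 < del ->
  (forall x, x \in cross ord0 ord0 ->
     corner del x <= X (idx x) t + Y x t <= corner del x + 2 * del) ->
  let H := hmat X idx Y t in
  [/\ del ^+ 2 <= n2 (H ord0 ord0), n2 (H ord0 ord0) <= 10 * del ^+ 2 &
      forall p q, (p == ord0) || (q == ord0) -> (p, q) != (ord0, ord0) ->
        n2 (H p q) <= 2 * del ^+ 2].
Proof.
move=> del0 h H.
have et : ((ord0, ord0, true) == (ord0, ord0, true) :> 'I_m.+1 * 'I_n.+1 * bool) = true.
  exact: eqxx.
have h00t := h (ord0, ord0, true); rewrite mem_cross eqxx /corner et in h00t.
have ef : ((ord0, ord0, false) == (ord0, ord0, true) :> 'I_m.+1 * 'I_n.+1 * bool) = false.
  by apply/negbTE/eqP; case.
have h00f := h (ord0, ord0, false); rewrite mem_cross eqxx /corner ef in h00f.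
have sq (a c : R) : - c <= a -> a <= c -> a ^+ 2 <= c ^+ 2.
  by move=> ac ca; rewrite -subr_ge0 subr_sqr mulr_ge0 //; lra.
have {h00t} /andP[h1 h2] := h00t isT.
have {h00f} /andP[h3 h4] := h00f isT.
have n2H p q : n2 (H p q) =
    (X (idx (p, q, true)) t + Y (p, q, true) t) ^+ 2 +
    (X (idx (p, q, false)) t + Y (p, q, false) t) ^+ 2 by rewrite mxE.
split; rewrite ?n2H.
- by rewrite -[del ^+ 2]addr0 lerD ?sqr_ge0 // sq //; lra.
- have -> : 10 * del ^+ 2 = (3 * del) ^+ 2 + del ^+ 2 by ring.
  by rewrite lerD // sq //; lra.
- move=> p q pq pq0; rewrite n2H.
  have := h (p, q, true); have := h (p, q, false); rewrite !mem_cross pq /corner.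
  have e b : ((p, q, b) == (ord0, ord0, true)) = false.
    by apply/negbTE; apply: contra pq0 => /eqP [-> -> _].
  rewrite !e => /(_ isT) /andP[a1 a2] /(_ isT) /andP[a3 a4].
  by rewrite mulr2n mulrDl mul1r lerD // sq //; lra.
Qed.

Theorem gdet_small m n alpha B : (forall j, 0 <= alpha j <= 1) -> 0 <= B ->
  exists K c, [/\ 0 < K, 0 < c & small_bound m n alpha B K c].
Proof.
elim: m n alpha B => [|m IH] n alpha B al B0.
  by exists 1, 1; split => //; apply: small_bound0 => // *; exact: gdet_row0.
case: n => [|n].
  by exists 1, 1; split => //; apply: small_bound0 => // *; exact: gdet_col0.
(* The eliminated term has squared modulus at most [(2 del^2)^2 / del^2 <= 4], so a pivot step
   raises the bound on the shifts by 2. *)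
have B20 : 0 <= B + 2 by rewrite addr_ge0.
have [K' [c' [K'0 c'0 sb]]] := IH n _ _ (fun j => al j.+1) B20.
have [cst cst1 Hc] := @gdet_schur R m n.
have [kap kap0 hkap] := normal_prob_itv_ge (B + 2).
have cst0 : 0 < cst := lt_le_trans ltr01 cst1.
(* 11 comes from [1 + rho * 10 del^2 <= 11 rho^(1 - alpha 0)]; the power of [kap] counts the real
   coordinates of the cross. *)
exists (11 * cst * K'), (c' * kap ^+ (2 * (m + n).+1)).
split; [by rewrite !mulr_gt0|by rewrite mulr_gt0 // exprn_gt0|].
move=> rho S idx Y A rho1 sh sA YB; have [inj nS law sY] := sh.
have rho0 : 0 < rho := lt_le_trans ltr01 rho1.
have /andP[al0 al1] := al 0%N.
pose del := rho `^ (- (alpha 0%N / 2)).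
have del0 : 0 < del by rewrite powR_gt0.
have del1 : del <= 1.
  by rewrite -(powRr0 rho) ler_powR // oppr_le0 divr_ge0.
have del2 : del ^+ 2 = rho `^ (- alpha 0%N).
  by rewrite -powR_mulrn ?powR_ge0 // -powRrM mulNr divfK.
pose u := @corner m n del.
pose E := [set t | forall x, x \in cross (ord0 : 'I_m.+1) (ord0 : 'I_n.+1) ->
  u x <= X (idx x) t + Y x t <= u x + 2 * del].
pose S' := next_set S idx ord0 ord0.
have SS' : S \subset S' by exact: finset.subsetUl.
have sAE : smeas X S' (A `&` E).
  apply: (smeas_all X S' A _ (fun x => [set t | u x <= X (idx x) t + Y x t <= u x + 2 * del])).
    exact: smeasS sA.
  move=> x xc; apply: smeas_itv; first by rewrite !inE map_f ?orbT.
  exact: sfunS (sY x).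
have PAE : (kap * del) ^+ (2 * (m + n).+1) * Pr P A <= Pr P (A `&` E).
  rewrite -(size_cross ord0 ord0).
  apply: (steps_ge P X mX indep idx Y S A _ u _ del B) => //.
  - by rewrite del0.
  - by rewrite mulr_ge0 // ltW.
  - by rewrite map_inj_uniq // uniq_cross.
  - by move=> x t _ At; exact: YB.
  - by move=> x; rewrite /u /corner; case: ifP => _; rewrite ?normrN ger0_norm // ltW.
  - move=> x c _ hc; rewrite /Pr law //; apply: hkap => //.
    by rewrite del1 ltW.
have hE t : (A `&` E) t -> _ := fun h => corner_entries m n idx Y del t del0 h.2.
have sh' := shifted_next P X S idx Y ord0 ord0 sh.
have YB' t x : (A `&` E) t -> `|next_shift X idx Y ord0 ord0 x t| <= B + 2.
  move=> AEt; have [n1 _ n3] := hE t AEt.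
  rewrite /next_shift (le_trans (ler_normB _ _)) // lerD //; first by apply: YB; case: AEt.
  case: x => [[p q] b]; rewrite /elim_term /=.
  set H := hmat X idx Y t in n1 n3 *; set z := _ / _.
  have nz : n2 z <= 2 ^+ 2.
    rewrite /z n2M n2V ler_pdivrMr; last by rewrite (lt_le_trans _ n1) // exprn_gt0.
    have hp : n2 (H (lift ord0 p) ord0) <= 2 * del ^+ 2.
      by apply: n3; rewrite ?eqxx ?orbT.
    have hq : n2 (H ord0 (lift ord0 q)) <= 2 * del ^+ 2.
      by apply: n3; rewrite ?eqxx.
    have d21 : del ^+ 2 <= 1 by rewrite exprn_ile1 // ltW.
    have d20 : 0 <= del ^+ 2 by exact: sqr_ge0.
    rewrite n2M; apply: le_trans (ler_pM (n2_ge0 _) (n2_ge0 _) hp hq) _.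
    by move: (n2 (H ord0 ord0)) (del ^+ 2) n1 d21 d20 => x y *; nra.
  have sq2 (a : R) : a ^+ 2 <= 2 ^+ 2 -> `|a| <= 2.
    by move=> a2; rewrite -(ler_sqr (normr_ge0 a)) ?nnegrE // real_normK ?num_real.
  case: b; apply: sq2; apply: le_trans nz; rewrite /n2 ?lerDl ?lerDr sqr_ge0 //.
have mE : measurable [set t | gdet rho (hmat X idx Y t) <=
    11 * cst * K' * rho `^ gain alpha m.+1 n.+1] by exact: measurable_gdet_le sh.
have mA := smeas_measurable X mX S _ sA.
apply: (@le_trans _ _ (Pr P (A `&` E `&` [set t | gdet rho
   (hmat X (idx \o sub_idx ord0 ord0) (next_shift X idx Y ord0 ord0) t)
     <= K' * rho `^ gain (fun j => alpha j.+1) m n]))); last first.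
  apply: Pr_le; [|exact: measurableI|].
    apply: measurableI; first exact: (smeas_measurable X mX _ _ sAE).
    exact: measurable_gdet_le sh'.
  move=> t [AEt /=]; have [n1 n10 n3] := hE t AEt; rewrite schur_hmat => hg.
  split => /=; first by case: AEt.
  set H := hmat X idx Y t in n1 n10 n3 hg *.
  have n4 p q : (p == ord0) || (q == ord0) -> n2 (H p q) <= 4 * n2 (H ord0 ord0).
    move=> pq; have [[-> ->]|pq0] := eqVneq (p, q) (ord0, ord0).
      by rewrite ler_peMl ?n2_ge0 // ler1n.
    by apply: le_trans (n3 _ _ pq pq0) _; have := sqr_ge0 del; lra.
  have [||_ hgd] := Hc rho ord0 ord0 H rho0.
  - by move=> p; apply: n4; rewrite eqxx orbT.
  - by move=> q; apply: n4; rewrite eqxx.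
  apply: le_trans hgd _.
  have -> : 11 * cst * K' * rho `^ gain alpha m.+1 n.+1 =
     11 * rho `^ (1 - alpha 0%N) * (K' * rho `^ gain (fun j => alpha j.+1) m n) * cst.
    by rewrite /= powRDp //; ring.
  rewrite ler_wpM2r ?(ltW cst0) // ler_pM //.
  - by rewrite addr_ge0 // mulr_ge0 ?n2_ge0 // ltW.
  - by rewrite (le_trans ler01) // gdet_ge1 // ltW.
  - have r1 : rho * del ^+ 2 = rho `^ (1 - alpha 0%N).
      by rewrite del2 powRDp // powRr1 // ltW.
    have r2 : 1 <= rho `^ (1 - alpha 0%N) by rewrite powR_ge1 // subr_ge0.
    have : rho * n2 (H ord0 ord0) <= rho * (10 * del ^+ 2) by rewrite ler_wpM2l // ltW.
    by move: r1 r2; move: (rho `^ _) => y; nra.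
apply: le_trans (sb rho S' _ _ _ rho1 sh' sAE YB').
have -> : c' * kap ^+ (2 * (m + n).+1) * rho `^ (- cost alpha m.+1 n.+1) * Pr P A =
  c' * rho `^ (- cost (fun j => alpha j.+1) m n) *
   ((kap * del) ^+ (2 * (m + n).+1) * Pr P A).
  have -> : (kap * del) ^+ (2 * (m + n).+1) =
      kap ^+ (2 * (m + n).+1) * rho `^ (- (alpha 0%N * (m + n).+1%:R)).
    by rewrite exprMn [del ^+ _]exprM del2 -powR_mulrn ?powR_ge0 // -powRrM mulNr.
  by rewrite [cost alpha _ _]/= opprD powRDp //; ring.
by rewrite ler_wpM2l // mulr_ge0 ?powR_ge0 // ltW.
Qed.

End OutageLower.
(** * Expected distortion *)

Section Expectation.
Context {d : measure_display} {T : measurableType d} {R : realType}.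
Context (P : probability T R).

Definition Ex (f : T -> R) : R := fine (\int[P]_t (f t)%:E)%E.

Lemma integral_scaled_indic (c : R) (E : set T) : 0 <= c -> measurable E ->
  (\int[P]_t (c * \1_E t)%:E = (c * Pr P E)%:E)%E.
Proof.
move=> c0 mE; under eq_integral do rewrite EFinM.
rewrite ge0_integralZl //.
  by rewrite integral_indic // setIT EFinM PrE.
by apply/measurable_EFinP; exact: measurable_indic.
Qed.

Lemma Ex_le_simple {J : finType} (c0 : R) (c : J -> R) (E : J -> set T) (f : T -> R) :
  0 <= c0 -> (forall j, 0 <= c j) -> (forall j, measurable (E j)) ->
  measurable_fun setT f -> (forall t, 0 <= f t) ->
  (forall t, f t <= c0 + \sum_j c j * \1_(E j) t) ->
  Ex f <= c0 + \sum_j c j * Pr P (E j).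
Proof.
move=> c00 cj0 mE mf f0 fle.
have mI j : measurable_fun setT (fun t => (c j * \1_(E j) t)%:E).
  by apply/measurable_EFinP; apply: measurable_funM => //; exact: measurable_indic.
have I0 j t : (0 <= (c j * \1_(E j) t)%:E)%E by rewrite lee_fin mulr_ge0.
have H : (\int[P]_t (f t)%:E <= (c0 + \sum_j c j * Pr P (E j))%:E)%E.
  apply: (@le_trans _ _ (\int[P]_t (c0%:E + \sum_j (c j * \1_(E j) t)%:E))%E).
    apply: ge0_le_integral => //.
    - by move=> t _; rewrite lee_fin.
    - exact/measurable_EFinP.
    - by apply: emeasurable_funD => //; exact: emeasurable_sum.
    - by move=> t _; rewrite sumEFin -EFinD lee_fin.
  rewrite ge0_integralD //; last 2 first.
    by move=> t _; apply: sume_ge0.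
    exact: emeasurable_sum.
  have -> : (\int[P]_(t in setT) c0%:E = c0%:E)%E.
    by rewrite (integral_cst P measurableT) [X in (_ * X)%E]probability_setT mule1.
  rewrite ge0_integral_sum //.
  rewrite EFinD -sumEFin leeD2l // lee_sum // => j _.
  by rewrite integral_scaled_indic.
have I00 : (0 <= \int[P]_t (f t)%:E)%E by apply: integral_ge0 => t _; rewrite lee_fin.
rewrite -lee_fin /Ex fineK // ge0_fin_numE //.
by apply: le_lt_trans H _; rewrite ltry.
Qed.

(** [fine] sends an infinite integral to 0, so the lower bound relies on [f <= 1] for finiteness. *)
Lemma Ex_ge_indic (c : R) (E : set T) (f : T -> R) :
  0 <= c -> measurable E -> measurable_fun setT f -> (forall t, 0 <= f t <= 1) ->
  (forall t, E t -> c <= f t) -> c * Pr P E <= Ex f.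
Proof.
move=> c0 mE mf f01 fge.
have H : ((c * Pr P E)%:E <= \int[P]_t (f t)%:E)%E.
  apply: (@le_trans _ _ (\int[P]_t (c * \1_E t)%:E)%E).
    by rewrite integral_scaled_indic.
  apply: ge0_le_integral => //.
  - by move=> t _; rewrite lee_fin mulr_ge0.
  - by apply/measurable_EFinP; apply: measurable_funM => //; exact: measurable_indic.
  - exact/measurable_EFinP.
  - move=> t _; rewrite lee_fin indicE; case: (boolP (t \in E)) => tE.
      by rewrite mulr1 fge // -in_setE.
    by rewrite mulr0; case/andP: (f01 t).
have I1 : (\int[P]_t (f t)%:E <= 1)%E.
  apply: (@le_trans _ _ (\int[P]_t 1)%E).
    apply: ge0_le_integral => //.
    - by move=> t _; rewrite lee_fin; case/andP: (f01 t).
    - exact/measurable_EFinP.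
    - by move=> t _; rewrite lee_fin; case/andP: (f01 t).
  by rewrite (integral_cst P measurableT) mul1e [X in (X <= _)%E]probability_setT.
rewrite -lee_fin /Ex fineK // ge0_fin_numE; first by rewrite (le_lt_trans I1) // ltry.
by apply: integral_ge0 => t _; rewrite lee_fin; case/andP: (f01 t).
Qed.

(** Meant for the event [0 <= Gam], which holds only almost surely; the distortion is not controlled
    outside it. *)
Lemma Ex_restrict (D : set T) (f : T -> R) : measurable D -> P (~` D) = 0%E ->
  measurable_fun setT f -> Ex f = Ex (fun t => f t * \1_D t).
Proof.
move=> mD PD mf; rewrite /Ex; congr fine.
apply: ae_eq_integral => //.
- exact/measurable_EFinP.
- by apply/measurable_EFinP; apply: measurable_funM => //; exact: measurable_indic.
exists (~` D); split => //; first exact: measurableC.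
move=> t /= h Dt; apply: h => _; rewrite indicE mem_set // mulr1 //.
Qed.

End Expectation.

(** * The exponential law of the side-information gain *)

Section GammaLaw.
Context {d : measure_display} {T : measurableType d} {R : realType}.
Context (P : probability T R) (Gam : T -> R).
Hypothesis mGam : measurable_fun setT Gam.
Hypothesis dGam : forall B, measurable B -> P (Gam @^-1` B) = exponential_prob 1 B.

Lemma Gam_itv (x : R) : 0 < x -> Pr P (Gam @^-1` `[0, x]%classic) = 1 - expR (- x).
Proof.
by move=> x0; rewrite /Pr dGam // exponential_prob_itv0c // mulN1r.
Qed.

Lemma Gam_itv_le (x : R) : 0 < x -> Pr P (Gam @^-1` `[0, x]%classic) <= x.
Proof. by move=> x0; rewrite Gam_itv //; have := expR_ge1Dx (- x); lra. Qed.

Lemma Gam_itv_ge (x : R) : 0 < x <= 1 -> x / 2 <= Pr P (Gam @^-1` `[0, x]%classic).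
Proof.
move=> /andP[x0 x1]; rewrite Gam_itv // expRN.
have h : (expR x)^-1 <= (1 + x)^-1.
  by rewrite lef_pV2 ?posrE ?expR_gt0 ?expR_ge1Dx // addr_gt0.
suff : (1 + x)^-1 <= 1 - x / 2 by lra.
rewrite -[X in X <= _]mul1r ler_pdivrMr ?addr_gt0 //; nra.
Qed.

Lemma Gam_ge0_ae : P (~` (Gam @^-1` `[0, +oo[%classic)) = 0%E.
Proof.
rewrite preimage_setC dGam; last by apply: measurableC; exact: measurable_itv.
rewrite /exponential_prob integral0_eq // => x /= xn.
by rewrite lt0_exponential_pdf //; move: xn; rewrite in_itv /= andbT => /negP; rewrite -ltNge.
Qed.

End GammaLaw.

(** * Piecewise linear formulas for the trade-off exponent *)

Section Exponents.
Context {R : realType}.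

(* The optimal sizes: for [k <= r <= k.+1] the first [k] pivots have exponent 0,
   the next one [k.+1 - r] and all others 1. *)
Definition frac (r : R) (j : nat) : R := Num.max 0 (Num.min 1 (j.+1%:R - r)).

Lemma frac01 r j : 0 <= frac r j <= 1.
Proof. by rewrite /frac le_max lexx /= ge_max ler01 /= ge_min lexx. Qed.

Lemma fracS r j : frac r j.+1 = frac (r - 1) j.
Proof. by rewrite /frac -natr1 opprB addrA [_ + 1 - r]addrAC. Qed.

Lemma frac_one r j : r <= j%:R -> frac r j = 1.
Proof.
move=> rj; rewrite /frac min_l; first by rewrite max_r.
by rewrite -natr1; lra.
Qed.

Lemma frac_zero r j : j.+1%:R <= r -> frac r j = 0.
Proof.
move=> rj; rewrite /frac max_l // ge_min; apply/orP; right.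
by rewrite subr_le0.
Qed.

Lemma frac_mid r j : j%:R <= r <= j.+1%:R -> frac r j = j.+1%:R - r.
Proof.
move=> /andP[jr rj]; rewrite /frac min_r; first by rewrite max_r // subr_ge0.
by move: jr; rewrite -natr1; lra.
Qed.

Lemma eq_cost (a a' : nat -> R) m n : a =1 a' -> cost a m n = cost a' m n.
Proof.
elim: m n a a' => [|m IH] [|n] a a' e //=.
by rewrite e (IH n _ (fun j => a' j.+1)) // => j; exact: e.
Qed.

Lemma cost_ge0 (a : nat -> R) m n : (forall j, 0 <= a j) -> 0 <= cost a m n.
Proof.
by elim: m n a => [|m IH] [|n] a a0 //=; rewrite addr_ge0 ?mulr_ge0 ?IH.
Qed.

Lemma gain_ge0 (a : nat -> R) m n : (forall j, a j <= 1) -> 0 <= gain a m n.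
Proof.
by elim: m n a => [|m IH] [|n] a a1 //=; rewrite addr_ge0 ?subr_ge0 ?IH.
Qed.

(** The weights [m + n - 1 - 2 j] of the pivots add up to [m n]. With [eta = 0] this is
    monotonicity. *)
Lemma cost_le (a a' : nat -> R) (eta : R) m n : 0 <= eta ->
  (forall j, a j <= a' j + eta) ->
  cost a m n <= cost a' m n + eta * (m%:R * n%:R).
Proof.
move=> eta0; elim: m n a a' => [|m IH] [|n] a a' h //=;
  rewrite ?mul0r ?mulr0 ?addr0 //.
have h1 := IH n _ _ (fun j => h j.+1).
have h2 : a 0%N * (m + n).+1%:R <= (a' 0%N + eta) * (m + n).+1%:R.
  by rewrite ler_wpM2r.
have -> : eta * (m.+1%:R * n.+1%:R) = eta * (m + n).+1%:R + eta * (m%:R * n%:R).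
  by rewrite -!natr1 natrD; ring.
by rewrite mulrDl in h2; lra.
Qed.

Lemma eq_gain (a a' : nat -> R) m n : a =1 a' -> gain a m n = gain a' m n.
Proof.
elim: m n a a' => [|m IH] [|n] a a' e //=.
by rewrite e (IH n _ (fun j => a' j.+1)) // => j; exact: e.
Qed.

(** The terms [1 - frac r j] cut [r] into unit steps, as far as there are pivots. *)
Lemma gain_frac r m n : gain (frac r) m n <= Num.max 0 r.
Proof.
elim: m n r => [|m IH] [|n] r; try by rewrite le_max lexx.
rewrite /=.
rewrite (eq_gain _ (frac (r - 1))); last exact: fracS.
apply: le_trans (lerD (lexx _) (IH n (r - 1))) _.
have [r0|r0] := leP r 0.
  by rewrite frac_one // subrr add0r ge_max lexx /=; lra.
have [r1|r1] := leP r 1.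
  rewrite frac_mid ?(ltW r0) //= opprB addrCA subrr addr0.
  rewrite max_l; first by rewrite addr0.
  by rewrite subr_le0.
rewrite frac_zero; last exact: ltW.
rewrite subr0 max_r; last by rewrite subr_ge0 ltW.
by rewrite addrC subrK.
Qed.

Lemma cost_one (a : nat -> R) m n : (forall j, a j = 1) -> cost a m n = m%:R * n%:R.
Proof.
elim: m n a => [|m IH] [|n] a a1 //=; rewrite ?mul0r ?mulr0 //.
by rewrite a1 mul1r IH // -!natr1 natrD; ring.
Qed.

Lemma cost_zero (a : nat -> R) m n : (forall j, (j < minn m n)%N -> a j = 0) ->
  cost a m n = 0.
Proof.
elim: m n a => [|m IH] [|n] a a0 //=.
rewrite a0 ?minnSS // mul0r add0r; apply: IH => j jm; apply: a0.
by rewrite minnSS.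
Qed.

(** The pivots after number [k] have exponent 1 and together cost the number of entries left,
    [(m - k - 1) (n - k - 1)]; pivot [k] costs its weight [m + n - 2 k - 1] times [k + 1 - r]. *)
Lemma cost_frac k m n r : (k < minn m n)%N -> k%:R <= r <= k.+1%:R ->
  cost (frac r) m n =
  (m%:R - k.+1%:R) * (n%:R - k.+1%:R) + (m%:R + n%:R - 2 * k%:R - 1) * (k.+1%:R - r).
Proof.
elim: k m n r => [|k IH] [|m] [|n] r //; rewrite ?minn0 // minnSS.
  move=> _ kr /=; rewrite frac_mid // cost_one => [|j].
    by rewrite -!natr1 natrD; ring.
  by rewrite frac_one //; case/andP: kr => _ /le_trans; apply; rewrite ler1n.
move=> kmn /andP[kr rk]; rewrite /= frac_zero; last first.
  by apply: le_trans kr; rewrite ler1n.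
rewrite mul0r add0r (eq_cost _ (frac (r - 1))); last exact: fracS.
rewrite IH //; first by rewrite -!natr1; ring.
by rewrite -[k.+2%:R]natr1 in rk; rewrite -natr1 in kr; rewrite lerBrDr kr lerBlDr rk.
Qed.

Lemma gexp_small (lam : R) m n : (m + n)%:R - 1 <= lam -> gexp lam m n = m%:R * n%:R.
Proof.
elim: m n => [|m IH] [|n] h //=; rewrite ?mul0r ?mulr0 //.
rewrite addnS addSn -natr1 addrK in h.
rewrite min_r // IH; first by rewrite -!natr1 natrD; ring.
by apply: le_trans h; rewrite -natr1; lra.
Qed.

(* [dmt] is piecewise linear and convex, and this lemma computes it on [k, k + 1]
   from the Chernoff exponent at the corresponding slope. *)
Lemma gexp_frac k m n r : (k < minn m n)%N -> k%:R <= r <= k.+1%:R ->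
  gexp (m%:R + n%:R - 2 * k%:R - 1) m n - (m%:R + n%:R - 2 * k%:R - 1) * r =
  cost (frac r) m n.
Proof.
move=> kmn kr; rewrite (cost_frac k) //.
suff -> : gexp (m%:R + n%:R - 2 * k%:R - 1) m n =
  k.+1%:R * (m%:R + n%:R - 2 * k%:R - 1) + (m%:R - k.+1%:R) * (n%:R - k.+1%:R) :> R by ring.
elim: k m n kmn {r kr} => [|k IH] [|m] [|n] //; rewrite ?minn0 // minnSS => kmn /=.
  have -> : m.+1%:R + n.+1%:R - 2 * 0 - 1 = (m + n).+1%:R :> R by rewrite -!natr1 natrD; ring.
  rewrite minxx gexp_small; first by rewrite -!natr1 natrD; ring.
  by rewrite -natr1; lra.
have -> : m.+1%:R + n.+1%:R - 2 * k.+1%:R - 1 = m%:R + n%:R - 2 * k%:R - 1 :> R.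
  by rewrite -!natr1; ring.
rewrite min_l; last first.
  by rewrite -[(m + n).+1%:R]natr1 natrD; have := ler0n R k; lra.
rewrite IH //.
have e j : j.+1%:R = j%:R + 1 :> R by rewrite natr1.
by rewrite !e; ring.
Qed.

End Exponents.

(** * The outage event compared with the channel determinant *)

Section Outage.
Context {R : realType} (Mt Mr : nat) (b eps : R).
Hypotheses (hb : 0 < b) (heps : 0 < eps).
Implicit Types (rho rs r gam : R) (H : 'M[R[i]]_(Mr, Mt)).

Lemma ln2_gt0 : 0 < ln 2 :> R.
Proof. by rewrite ln_gt0 // ltr1n. Qed.

Lemma pow2_log2 rho y : 0 < rho -> pow2 (y * log2 rho) = rho `^ y.
Proof.
move=> rho0; rewrite /pow2 /log2 /powR gt_eqF // mulrA divfK //.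
by rewrite gt_eqF // ln2_gt0.
Qed.

Lemma pow20 : pow2 0 = 1 :> R.
Proof. by rewrite /pow2 mul0r expR0. Qed.

Lemma pow2_rate rho r : 0 < rho -> pow2 (b * (r * log2 rho)) = rho `^ (b * r).
Proof. by move=> rho0; rewrite mulrA pow2_log2. Qed.

Lemma pow2_rate_eps rho r : 0 < rho ->
  pow2 (b * (r * log2 rho) - eps) = rho `^ (b * r) * pow2 (- eps).
Proof. by move=> rho0; rewrite /pow2 mulrDl expRD -/(pow2 _) -/(pow2 _) pow2_rate. Qed.

Lemma pow2_eps01 : 0 < pow2 (- eps) < 1.
Proof. by rewrite expR_gt0 /pow2 expR_lt1 mulNr oppr_lt0 mulr_gt0 // ln2_gt0. Qed.

Definition snr rho : R := rho / (Mlo Mt Mr)%:R.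

Lemma log2_le (x y : R) : 0 < x -> x <= y -> log2 x <= log2 y.
Proof.
move=> x0 xy; rewrite /log2 ler_wpM2r ?invr_ge0 ?(ltW ln2_gt0) //.
by rewrite ler_ln ?posrE // (lt_le_trans x0).
Qed.

(** The side information only divides by [den >= 1], so the threshold is at most [2 rho^(b r)]
    whatever [gam] is; the [b]-th root gives the constant [2^(1/b)]. *)
Lemma outage_gdet rho rs r H gam : 1 <= rho -> 0 < rs -> 0 <= r -> 0 <= gam ->
  outage_ld Mt Mr b eps rho rs (r * log2 rho) H gam ->
  gdet (snr rho) H <= 2 `^ b^-1 * rho `^ r.
Proof.
move=> rho1 rs0 r0 gam0; have rho0 : 0 < rho := lt_le_trans ltr01 rho1.
rewrite /outage_ld pow2_rate_eps // /logdet -/(gdet _ _) -/(snr rho).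
set G := gdet _ _; set q := rho `^ _; set den := gam * rs + 1.
have G1 : 1 <= G by rewrite gdet_ge1 // divr_ge0 // ltW.
have G0 : 0 < G := lt_le_trans ltr01 G1.
have q1 : 1 <= q by rewrite powR_ge1 // mulr_ge0 // ltW.
have q0 : 0 < q := lt_le_trans ltr01 q1.
have den1 : 1 <= den by rewrite lerDr mulr_ge0 // ltW.
have den0 : 0 < den := lt_le_trans ltr01 den1.
have /andP[e0 e1] := pow2_eps01.
have qe : 0 < q * pow2 (- eps) <= q by rewrite mulr_gt0 //= ler_piMr // ltW.
case/andP: qe => qe0 qe1.
set X := 1 + _ => bX.
have X0 : 0 < X.
  suff : - 1 < (q * pow2 (- eps) - 1) / den by rewrite /X; lra.
  by rewrite ltr_pdivlMr //; lra.
have Xq : X <= 2 * q.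
  suff : (q * pow2 (- eps) - 1) / den <= q by rewrite /X; lra.
  by rewrite ler_pdivrMr //; nra.
have {}bX : b * log2 G <= log2 (2 * q) := le_trans bX (log2_le _ _ X0 Xq).
have l2 := ln2_gt0.
have {}bX : b * ln G <= ln (2 * q).
  by move: bX; rewrite /log2 mulrA ler_pM2r // invr_gt0.
have -> : 2 `^ b^-1 * rho `^ r = (2 * q) `^ b^-1.
  rewrite powRM // ?(ltW q0) // /q -powRrM [b * r]mulrC mulfK //.
  by rewrite gt_eqF.
rewrite -ler_ln ?posrE ?powR_gt0 ?mulr_gt0 // ln_powR.
by rewrite -(ler_pM2l hb) mulrA divff ?gt_eqF // mul1r.
Qed.

(** A side SNR [gam * rs <= 1] at most halves [q - 1], so the threshold is still at least
    [q / 2]. *)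
Lemma gdet_outage rho rs r H gam : 1 <= rho -> 0 < rs -> 0 <= r -> 0 <= gam ->
  gam * rs <= 1 -> 1 <= rho `^ (b * r) * pow2 (- eps) ->
  gdet (snr rho) H `^ b <= rho `^ (b * r) * pow2 (- eps) / 2 ->
  outage_ld Mt Mr b eps rho rs (r * log2 rho) H gam.
Proof.
move=> rho1 rs0 r0 gam0 gr q1 hG; have rho0 : 0 < rho := lt_le_trans ltr01 rho1.
rewrite /outage_ld pow2_rate_eps // /logdet -/(gdet _ _) -/(snr rho).
move: q1 hG; set G := gdet _ _; set q := rho `^ _ * _ => q1 hG.
have G1 : 1 <= G by rewrite gdet_ge1 // divr_ge0 // ltW.
have G0 : 0 < G := lt_le_trans ltr01 G1.
have -> : b * log2 G = log2 (G `^ b) by rewrite /log2 ln_powR mulrA.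
apply: log2_le; first exact: powR_gt0.
apply: le_trans hG _.
have den0 : 0 < gam * rs + 1 by rewrite ltr_wpDl // mulr_ge0 // ltW.
suff : (q - 1) / 2 <= (q - 1) / (gam * rs + 1) by lra.
rewrite ler_wpM2l ?subr_ge0 // lef_pV2 ?posrE //; lra.
Qed.

Lemma Dd_le rs Rt gam : 0 < rs -> 0 <= gam -> 0 <= Rt ->
  0 < Dd rs Rt gam <= (rs * gam + 1)^-1.
Proof.
move=> rs0 g0 R0; have p1 : 1 <= pow2 Rt.
  rewrite /pow2 -[X in X <= _]expR0 ler_expR mulr_ge0 //; exact/ltW/ln2_gt0.
have rg : 0 <= rs * gam by rewrite mulr_ge0 // ltW.
have p0 : 0 < pow2 Rt := lt_le_trans ltr01 p1.
by rewrite /Dd invr_gt0 lef_pV2 ?posrE ?lerD2l ?ltr_wpDl.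
Qed.

Lemma Dld_le rho rs Rt H gam : 0 < rs -> 0 <= gam -> 0 <= b * Rt ->
  0 < Dld Mt Mr b eps rho rs Rt H gam <= (rs * gam + 1)^-1.
Proof. by move=> *; rewrite /Dld; case: ifP => _; exact: Dd_le. Qed.

Lemma Dld_le1 rho rs Rt H gam : 0 < rs -> 0 <= gam -> 0 <= b * Rt ->
  0 < Dld Mt Mr b eps rho rs Rt H gam <= 1.
Proof.
move=> rs0 g0 R0; have /andP[-> h] := Dld_le rho rs Rt H gam rs0 g0 R0.
apply: le_trans h _; rewrite invf_le1 ?lerDr ?ltr_wpDl // mulr_ge0 //; exact: ltW.
Qed.

Lemma Dld_ge rho rs Rt H gam : 0 < rs -> 0 <= gam -> 0 <= b * Rt ->
  (rs * gam + pow2 (b * Rt))^-1 <= Dld Mt Mr b eps rho rs Rt H gam.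
Proof.
move=> rs0 g0 R0; rewrite /Dld; case: ifP => // _.
by have := Dd_le rs _ gam rs0 g0 R0 => /andP[_]; rewrite /Dd pow20.
Qed.

End Outage.

(** * Bounds on the expected distortion at a fixed SNR *)

Section Distortion.
Context {Mt Mr : nat}.
Context {d : measure_display} {T : measurableType d} {R : realType}.
Context (P : probability T R).
Context (Hre Him : 'I_Mr -> 'I_Mt -> T -> R) (Gam : T -> R).
Hypothesis mHre : forall i j, measurable_fun setT (Hre i j).
Hypothesis mHim : forall i j, measurable_fun setT (Him i j).
Hypothesis mGam : measurable_fun setT Gam.
Hypothesis indep : mutually_independent P (rv_family Hre Him Gam).
Hypothesis dHre : forall i j B, measurable B ->
  P (Hre i j @^-1` B) = normal_prob 0 (Num.sqrt (2^-1)) B.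
Hypothesis dHim : forall i j B, measurable B ->
  P (Him i j @^-1` B) = normal_prob 0 (Num.sqrt (2^-1)) B.
Hypothesis dGam : forall B, measurable B -> P (Gam @^-1` B) = exponential_prob 1 B.

Local Notation X := (rv_family Hre Him Gam).
Local Notation H t := (chanH (fun i j => Hre i j t) (fun i j => Him i j t)).
Local Notation D := (Gam @^-1` `[0, +oo[%classic).

Let mX o : measurable_fun setT (X o).
Proof. by case: o => [[[i j] []]|] /=. Qed.

Let hentries : 'I_Mr * 'I_Mt * bool -> option ('I_Mr * 'I_Mt * bool) := Some.
Let SH : {set option ('I_Mr * 'I_Mt * bool)} := [set o | o != None].

Let hmatE t : hmat X hentries (fun _ _ => 0) t = H t.
Proof. by apply/matrixP => i j; rewrite !mxE /entry /= !addr0. Qed.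

Let shifted0 : shifted P X finset.set0 hentries (fun _ _ => 0).
Proof.
split=> [x y []//|x|[[i j] []] B mB /=|x]; rewrite ?inE //; first exact: dHre.
  exact: dHim.
exact: measurable_cst.
Qed.

Let cH i j : @cfun _ (g_sigma_algebraType (gens X SH)) _ (fun t => H t i j).
Proof.
by split; under eq_fun do rewrite mxE /=;
  [apply: (sfun_var X SH (Some (i, j, true)))|apply: (sfun_var X SH (Some (i, j, false)))];
  rewrite inE.
Qed.

Let gdet_hmat rho s : [set t | gdet rho (H t) <= s] =
  [set t | gdet rho (hmat X hentries (fun _ _ => 0) t) <= s].
Proof. by apply/seteqP; split => t /=; rewrite hmatE. Qed.

Let PrT : Pr P setT = 1.
Proof. by rewrite /Pr probability_setT. Qed.

Let smeasT S : smeas X S (setT : set T).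
Proof. exact: (@measurableT _ (g_sigma_algebraType (gens X S))). Qed.

Lemma smeas_gdet_le rho s : smeas X SH [set t | gdet rho (H t) <= s].
Proof.
rewrite -[X in smeas _ _ X]setTI.
apply: (@measurable_fun_le _ (g_sigma_algebraType (gens X SH))) => //.
exact: measurable_gdet.
Qed.

Lemma measurable_gdetH rho : measurable_fun setT (fun t => gdet rho (H t)).
Proof.
apply: measurable_gdet => i j.
by split; apply: (measurable_sfun X mX SH); case: (cH i j).
Qed.

Lemma gdetH_tail lam e : 0 <= lam -> 0 < e ->
  exists2 C, 0 < C & forall rho s, 1 <= rho -> 0 < s ->
    Pr P [set t | gdet rho (H t) <= s] <= C * s `^ lam * rho `^ (- gexp lam Mr Mt + e).
Proof.
move=> lam0 e0; have [C C0 tb] := gdet_tail P X mX indep Mr Mt lam e lam0 e0.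
exists C => // rho s rho1 s0.
have := tb rho s _ _ _ setT rho1 s0 shifted0 (smeasT _).
by rewrite setTI PrT mulr1 => h; rewrite gdet_hmat.
Qed.

Lemma gdetH_small alpha : (forall j, 0 <= alpha j <= 1) ->
  exists K c, [/\ 0 < K, 0 < c & forall rho, 1 <= rho ->
    c * rho `^ (- cost alpha Mr Mt) <=
    Pr P [set t | gdet rho (H t) <= K * rho `^ gain alpha Mr Mt]].
Proof.
move=> al; have [K [c [K0 c0 sb]]] := gdet_small P X mX indep Mr Mt alpha 0 al (lexx _).
exists K, c; split => // rho rho1.
have := sb rho _ _ _ setT rho1 shifted0 (smeasT _).
rewrite setTI PrT mulr1 => h; rewrite gdet_hmat; apply: h => t x _.
by rewrite normr0.
Qed.

Lemma Pr_Gam_indep A B : smeas X SH A -> measurable B ->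
  Pr P (A `&` Gam @^-1` B) = Pr P A * Pr P (Gam @^-1` B).
Proof. by move=> sA mB; apply: (Pr_indep P X mX indep SH None) => //; rewrite inE. Qed.

Section OneSNR.
Context (b eps rho rs Rt : R).
Hypotheses (rs0 : 0 < rs) (bRt : 0 <= b * Rt).

Definition dist t := Dld Mt Mr b eps rho rs Rt (H t) (Gam t).

Lemma measurable_dist : measurable_fun setT dist.
Proof.
have mO : measurable [set t | outage_ld Mt Mr b eps rho rs Rt (H t) (Gam t)].
  rewrite -[X in measurable X]setTI; rewrite /outage_ld.
  apply: measurable_fun_le => //.
    rewrite /logdet /log2; apply: measurable_funM => //; apply: measurable_funM => //.
    apply: (@measurableT_comp _ _ _ _ _ _ (@ln R)); first exact: measurable_ln.
    exact: measurable_gdetH.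
  apply: measurable_funM => //.
  apply: (@measurableT_comp _ _ _ _ _ _ (@ln R)); first exact: measurable_ln.
  apply: measurable_funD => //; apply: measurable_funM => //.
  apply: measurable_fun_inv; apply: measurable_funD => //.
  exact: measurable_funM.
have mD Rt' : measurable_fun setT (fun t => Dd rs Rt' (Gam t)).
  apply: measurable_fun_inv; apply: measurable_funD => //.
  exact: measurable_funM.
set O := [set t | _] in mO.
have -> : dist = fun t => Dd rs 0 (Gam t) * \1_O t + Dd rs (b * Rt) (Gam t) * \1_(~` O) t.
  apply/funext => t; rewrite /dist /Dld !indicE in_setC.
  have -> : (t \in O) = `[< outage_ld Mt Mr b eps rho rs Rt (H t) (Gam t) >].
    by apply/idP/asboolP => [|h]; rewrite ?in_setE // inE.
  by case: asboolP => _; rewrite !(mulr1, mulr0, addr0, add0r).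
apply: measurable_funD; apply: measurable_funM => //; apply: measurable_indic => //.
exact: measurableC.
Qed.

Lemma measurable_D : measurable D.
Proof. by rewrite -[D]setTI; apply: mGam => //; exact: measurable_itv. Qed.

Lemma ED_restrict : ED_ld P Hre Him Gam b eps rs rho Rt = Ex P (fun t => dist t * \1_D t).
Proof.
have -> : ED_ld P Hre Him Gam b eps rs rho Rt = Ex P dist by [].
apply: Ex_restrict; [exact: measurable_D|exact: Gam_ge0_ae|exact: measurable_dist].
Qed.

Lemma measurable_distD : measurable_fun setT (fun t => dist t * \1_D t).
Proof.
apply: measurable_funM; first exact: measurable_dist.
exact/measurable_indic/measurable_D.
Qed.

Lemma DP t : reflect (0 <= Gam t) (t \in D).
Proof. by apply: (iffP idP); rewrite in_setE /= in_itv /= andbT. Qed.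

Lemma distD01 t : 0 <= dist t * \1_D t <= 1.
Proof.
rewrite indicE; case: DP => g0; last by rewrite mulr0 lexx ler01.
by rewrite mulr1; have /andP[/ltW -> ->] :=
  Dld_le1 Mt Mr b eps rho rs Rt (H t) (Gam t) rs0 g0 bRt.
Qed.

(** [Gam <= 1] has probability at least 1/2, and there even a decoded block has distortion at least
    [1 / (rs + 2^(b Rt))]. *)
Lemma ED_ge_noise : (4 * (rs + pow2 (b * Rt)))^-1 <= ED_ld P Hre Him Gam b eps rs rho Rt.
Proof.
rewrite ED_restrict.
have mE : measurable (Gam @^-1` `[0, 1]%classic).
  by rewrite -[_ @^-1` _]setTI; apply: mGam => //; exact: measurable_itv.
have q0 : 0 < pow2 (b * Rt) by exact: expR_gt0.
have s0 : 0 < rs + pow2 (b * Rt) by rewrite addr_gt0.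
apply: le_trans (Ex_ge_indic P ((2 * (rs + pow2 (b * Rt)))^-1) _ _ _ mE measurable_distD distD01 _).
- have : 1 / 2 <= Pr P (Gam @^-1` `[0, 1]%classic).
    by apply: Gam_itv_ge; rewrite // ltr01 lexx.
  move=> h; apply: le_trans (ler_wpM2l _ h); last by rewrite invr_ge0 mulr_ge0 // ltW.
  by rewrite mul1r -invfM mulrAC -natrM.
- by rewrite invr_ge0 mulr_ge0 // ltW.
- move=> t /=; rewrite in_itv /= => /andP[g0 g1].
  rewrite indicE; case: DP => // _; rewrite mulr1.
  apply: le_trans (Dld_ge Mt Mr b eps rho rs Rt (H t) (Gam t) rs0 g0 bRt).
  rewrite lef_pV2 ?posrE ?mulr_gt0 ?ltr_wpDl ?mulr_ge0 ?(ltW rs0) //.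
  have : rs * Gam t <= rs * 1 by rewrite ler_wpM2l // ltW.
  by rewrite mulr1; lra.
Qed.

(** Where [Gam <= 1 / (1 + rs)], an event of probability at least [1 / (2 (1 + rs))], the side
    information helps neither the decoder nor the estimate: [A] causes outage and the distortion is
    at least 1/2. This is the origin of the [nu] added to [dmt]. *)
Lemma ED_ge_outage A : smeas X SH A ->
  (forall t, A t -> 0 <= Gam t -> Gam t * rs <= 1 ->
     outage_ld Mt Mr b eps rho rs Rt (H t) (Gam t)) ->
  Pr P A / (4 * (1 + rs)) <= ED_ld P Hre Him Gam b eps rs rho Rt.
Proof.
move=> sA hA; rewrite ED_restrict.
have mA := smeas_measurable X mX SH _ sA.
set x := (1 + rs)^-1.
have x01 : 0 < x <= 1 by rewrite invr_gt0 invf_le1 ?lerDl ?addr_gt0 ?(ltW rs0).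
have mB : measurable (`[0, x]%classic : set R) by exact: measurable_itv.
have mE : measurable (Gam @^-1` `[0, x]%classic).
  by rewrite -[_ @^-1` _]setTI; exact: mGam.
apply: le_trans (Ex_ge_indic P (2^-1) (A `&` Gam @^-1` `[0, x]%classic) _ _ _ measurable_distD distD01 _).
- rewrite Pr_Gam_indep //.
  have h : x / 2 <= Pr P (Gam @^-1` `[0, x]%classic) by exact: Gam_itv_ge.
  have -> : Pr P A / (4 * (1 + rs)) = 2^-1 * (Pr P A * (x / 2)).
    by rewrite /x invfM -[(4 : R)]/((2 * 2)%:R) natrM invfM; ring.
  by rewrite ler_wpM2l // ler_wpM2l // Pr_ge0.
- by [].
- exact: measurableI.
- move=> t [At /=]; rewrite in_itv /= => /andP[g0 gx].
  have rg : rs * Gam t <= 1.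
    apply: le_trans (ler_wpM2l (ltW rs0) gx) _.
    by rewrite /x ler_pdivrMr ?addr_gt0 // mul1r lerDr.
  rewrite indicE; case: DP => // _; rewrite mulr1 /dist /Dld.
  case: asboolP => [_|]; last by case; apply: hA => //; rewrite mulrC.
  rewrite /Dd pow20 lef_pV2 ?posrE ?ltr_wpDl ?mulr_ge0 ?(ltW rs0) //.
  by move: rg; lra.
Qed.

(** Between neighbouring levels the distortion is at most [1 / (rs * level V L l)] and the
    probability at most the previous level, so their product is at most [V^(1/L) / rs]; below the
    last level, distortion 1 meets probability [1 / V]. Later [V = rho^nu], which makes both about
    [rho^(- nu)]. *)
Lemma ED_le_outage (V : R) (L : nat) (M c0 : R) A : smeas X SH A ->
  1 <= V -> (0 < L)%N -> 0 <= c0 ->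
  V `^ (L%:R^-1) / rs <= M -> V^-1 <= M ->
  (forall t, 0 <= Gam t -> dist t <= c0 + \1_A t * (rs * Gam t + 1)^-1) ->
  ED_ld P Hre Him Gam b eps rs rho Rt <= c0 + L.+2%:R * M * Pr P A.
Proof.
move=> sA V1 L0 c00 M1 M2 hA; rewrite ED_restrict.
have mA := smeas_measurable X mX SH _ sA.
have V0 : 0 < V := lt_le_trans ltr01 V1.
have Lr0 : 0 < L%:R :> R by rewrite ltr0n.
have lv0 l : 0 < level V L l by rewrite powR_gt0.
pose c (l : 'I_L.+2) : R := if (l : nat) == L.+1 then 1 else (rs * level V L l)^-1.
pose B (l : 'I_L.+2) : set R :=
  if (l : nat) is l'.+1 then `[0, level V L l']%classic else setT.
have mB l : measurable (B l).
  by rewrite /B; case: (l : nat) => [|l']; [exact: measurableT|exact: measurable_itv].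
have mGB l : measurable (Gam @^-1` B l) by rewrite -[_ @^-1` _]setTI; exact: mGam.
have c_ge0 l : 0 <= c l.
  by rewrite /c; case: ifP => // _; rewrite invr_ge0 mulr_ge0 // ltW.
apply: le_trans (Ex_le_simple P c0 c (fun l => A `&` Gam @^-1` B l) _ c00 c_ge0 _
  measurable_distD _ _) _.
- by move=> l; exact: measurableI.
- by move=> t; case/andP: (distD01 t).
- move=> t; rewrite indicE; case: DP => g0; last first.
    by rewrite mulr0 addr_ge0 // sumr_ge0 // => l _; rewrite mulr_ge0.
  rewrite mulr1; apply: le_trans (hA t g0) _; rewrite lerD2l indicE.
  case: (boolP (t \in A)) => tA; last first.
    by rewrite mul0r sumr_ge0 // => l _; rewrite mulr_ge0.
  rewrite mul1r.
  have ex : exists l, level_lo V L l <= Gam t by exists L.+1; rewrite /level_lo eqxx.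
  have [l hl lmin] := ex_minnP ex.
  have lL : (l < L.+2)%N by rewrite ltnS; apply: lmin; rewrite /level_lo eqxx.
  rewrite (bigD1 (Ordinal lL)) //= -[X in X <= _]addr0 lerD //; last first.
    by rewrite sumr_ge0 // => j _; rewrite mulr_ge0.
  rewrite indicE mem_set ?mulr1.
    have rg : 0 <= rs * Gam t by rewrite mulr_ge0 // ltW.
    rewrite /c /=; case: eqP => [_|lLn].
      by rewrite invf_le1 ?lerDr // ltr_wpDl.
    move: hl; rewrite /level_lo; case: eqP => // _ hl.
    rewrite lef_pV2 ?posrE ?mulr_gt0 ?ltr_wpDl //.
    by apply: le_trans (ler_wpM2l (ltW rs0) hl) _; rewrite lerDl.
  split; first by rewrite -in_setE.
  rewrite /B /=; case: l hl lmin lL => // l hl lmin lL; rewrite /= in_itv /= g0 /=.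
  have : ~~ (level_lo V L l <= Gam t) by apply/negP => /lmin; rewrite ltnn.
  by rewrite -ltNge /level_lo ltn_eqF // => /ltW.
rewrite lerD2l -mulrA -[L.+2%:R]/((L.+2)%:R) mulr_natl -[X in _ *+ X]card_ord -sumr_const.
apply: ler_sum => l _; rewrite Pr_Gam_indep // mulrCA mulrC ler_wpM2r ?Pr_ge0 //.
have pB : Pr P (Gam @^-1` B l) <= (if (l : nat) is l'.+1 then level V L l' else 1).
  rewrite /B; case: (l : nat) => [|l']; first by rewrite preimage_setT Pr_le1.
  exact: Gam_itv_le.
apply: le_trans (ler_wpM2l (c_ge0 l) pB) _; rewrite /c.
have V1L : V `^ L%:R^-1 >= 1 by rewrite powR_ge1 // invr_ge0 ltW.
have lvS j : level V L j / level V L j.+1 = V `^ (L%:R^-1).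
  rewrite -powRN opprK -powRDp // -natr1 mulrDl mul1r; congr (_ `^ _); ring.
case: l {pB} => [] [|l] lL /=.
  rewrite mulr1 /level mul0r oppr0 powRr0 mulr1; apply: le_trans M1.
  by rewrite -[X in X <= _]mul1r ler_wpM2r // invr_ge0 ltW.
case: eqP => [[->]|_].
  by rewrite mul1r /level divff ?gt_eqF // powR_inv1 // ltW.
apply: le_trans M1; rewrite -(lvS l) invfM.
by rewrite [X in X <= _](_ : _ = level V L l / level V L l.+1 / rs) //; ring.
Qed.

End OneSNR.

End Distortion.
(** * Exponents as the SNR grows *)

Section Asymptotics.
Context {R : realType}.

Lemma log2_ge0 (x : R) : 1 <= x -> 0 <= log2 x.
Proof. by move=> x1; apply: divr_ge0; [exact: ln_ge0|exact/ltW/ln2_gt0]. Qed.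

Lemma rate_ge0 (b r rho : R) : 0 <= b -> 0 <= r -> 1 <= rho ->
  0 <= b * (r * log2 rho).
Proof.
by move=> b0 r0 rho1; do 2! apply: mulr_ge0 => //; exact: log2_ge0.
Qed.

Lemma near_powR_ge (K eta : R) : 0 < eta -> \forall rho \near +oo, K <= rho `^ eta.
Proof.
move=> eta0; near=> rho.
have rho1 : 1 <= rho by near: rho; exact: nbhs_pinfty_ge.
have [K0|K0] := leP K 0; first by apply: le_trans K0 _; exact: powR_ge0.
have h : K `^ eta^-1 <= rho by near: rho; exact: nbhs_pinfty_ge.
have -> : K = (K `^ eta^-1) `^ eta by rewrite -powRrM mulVf ?gt_eqF // powRr1 // ltW.
by rewrite ge0_ler_powR ?nnegrE ?powR_ge0 ?(ltW eta0) // (le_trans ler01).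
Unshelve. all: by end_near. Qed.

Lemma exponent_cvg (E : R -> R) (e : R) :
  (forall eps, 0 < eps -> \forall rho \near +oo,
     rho `^ (- (e + eps)) <= E rho <= rho `^ (- (e - eps))) ->
  (fun rho => - log2 (E rho) / log2 rho) @ +oo --> e.
Proof.
move=> hE; apply/cvgrPdist_le => eps eps0; near=> rho.
have rho1 : 1 < rho by near: rho; exact: nbhs_pinfty_gt.
have rho0 : 0 < rho by exact: lt_trans rho1.
have l0 : 0 < ln rho by rewrite ln_gt0.
have : rho `^ (- (e + eps)) <= E rho <= rho `^ (- (e - eps)) by near: rho; exact: hE.
move=> /andP[h1 h2].
have E0 : 0 < E rho by apply: lt_le_trans h1; rewrite powR_gt0.
have g1 : - (e + eps) * ln rho <= ln (E rho).
  by rewrite -ln_powR ler_ln ?posrE ?powR_gt0.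
have g2 : ln (E rho) <= - (e - eps) * ln rho.
  by rewrite -ln_powR ler_ln ?posrE ?powR_gt0.
have -> : - log2 (E rho) / log2 rho = - ln (E rho) / ln rho.
  by rewrite /log2; field; rewrite !gt_eqF // ln2_gt0.
have q1 : - ln (E rho) / ln rho <= e + eps by rewrite ler_pdivrMr //; lra.
have q2 : e - eps <= - ln (E rho) / ln rho by rewrite ler_pdivlMr //; lra.
by rewrite ler_norml; apply/andP; split; lra.
Unshelve. all: by end_near. Qed.

Lemma exponent_bounds (f : R -> R) (nu eta : R) : (forall rho, 0 < f rho) ->
  (fun rho => log2 (f rho) / log2 rho) @ +oo --> nu -> 0 < eta ->
  \forall rho \near +oo, rho `^ (nu - eta) <= f rho <= rho `^ (nu + eta).
Proof.
move=> f0 fnu eta0; near=> rho.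
have rho1 : 1 < rho by near: rho; exact: nbhs_pinfty_gt.
have rho0 : 0 < rho by exact: lt_trans rho1.
have l0 : 0 < ln rho by rewrite ln_gt0.
have : `|nu - log2 (f rho) / log2 rho| <= eta.
  by near: rho; move/cvgrPdist_le : fnu; exact.
have -> : log2 (f rho) / log2 rho = ln (f rho) / ln rho.
  by rewrite /log2; field; rewrite !gt_eqF // ln2_gt0.
rewrite ler_norml => /andP[h1 h2].
have g1 : ln (f rho) <= (nu + eta) * ln rho by rewrite -ler_pdivrMr //; lra.
have g2 : (nu - eta) * ln rho <= ln (f rho) by rewrite -ler_pdivlMr //; lra.
by rewrite -[X in X && _]ler_ln ?posrE ?powR_gt0 // ln_powR g2 /=
  -ler_ln ?posrE ?powR_gt0 // ln_powR.
Unshelve. all: by end_near. Qed.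

End Asymptotics.

(** * The distortion exponent at a fixed rate *)

Section Exponent.
Context {Mt Mr : nat} (hMt : (1 <= Mt)%N) (hMr : (1 <= Mr)%N).
Context {d : measure_display} {T : measurableType d} {R : realType}.
Context (P : probability T R).
Context (Hre Him : 'I_Mr -> 'I_Mt -> T -> R) (Gam : T -> R).
Hypothesis mHre : forall i j, measurable_fun setT (Hre i j).
Hypothesis mHim : forall i j, measurable_fun setT (Him i j).
Hypothesis mGam : measurable_fun setT Gam.
Hypothesis indep : mutually_independent P (rv_family Hre Him Gam).
Hypothesis dHre : forall i j B, measurable B ->
  P (Hre i j @^-1` B) = normal_prob 0 (Num.sqrt (2^-1)) B.
Hypothesis dHim : forall i j B, measurable B ->
  P (Him i j @^-1` B) = normal_prob 0 (Num.sqrt (2^-1)) B.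
Hypothesis dGam : forall B, measurable B -> P (Gam @^-1` B) = exponential_prob 1 B.
Context (nu : R) (hnu : 0 <= nu) (rhos : R -> R) (hrhos : forall rho, 0 < rhos rho).
Hypothesis hrhos_exp : (fun rho => log2 (rhos rho) / log2 rho) @ +oo --> nu.
Context (b eps : R) (hb : 0 < b) (heps : 0 < eps).

Local Notation H t := (chanH (fun i j => Hre i j t) (fun i j => Him i j t)).
Local Notation ED r rho := (ED_ld P Hre Him Gam b eps (rhos rho) rho (r * log2 rho)).

Definition dmt (r : R) : R := cost (frac r) Mr Mt.
Definition expo (r : R) : R := Num.min (Num.max nu (b * r)) (dmt r + nu).

Lemma dmt_ge0 r : 0 <= dmt r.
Proof. by apply: cost_ge0 => j; case/andP: (frac01 r j). Qed.

Let M : R := (Mlo Mt Mr)%:R.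

Let M1 : 1 <= M.
Proof. by rewrite /M ler1n leq_min hMt hMr. Qed.

Let M0 : 0 < M := lt_le_trans ltr01 M1.

Lemma gdet_dmt r eta : 0 <= r -> 0 < eta -> exists2 C, 0 < C &
  forall rho, M <= rho ->
  Pr P [set t | gdet (snr Mt Mr rho) (H t) <= 2 `^ b^-1 * rho `^ r] <=
  C * rho `^ (- dmt r + eta).
Proof.
move=> r0 eta0.
have rho1 rho : M <= rho -> 1 <= rho := le_trans M1.
(* From the maximal multiplexing gain on, [dmt] vanishes and the bound 1 on a probability
   suffices. *)
have [rm|rm] := leP (minn Mr Mt)%:R r.
  exists 1 => // rho Mrho; rewrite mul1r.
  have -> : dmt r = 0.
    apply: cost_zero => j jm; apply: frac_zero; apply: le_trans rm.
    by rewrite ler_nat.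
  rewrite oppr0 add0r; apply: le_trans (powR_ge1 _ _ (rho1 _ Mrho) (ltW eta0)).
  apply: Pr_le1; rewrite -[X in measurable X]setTI.
  by apply: measurable_fun_le => //; exact: (measurable_gdetH Hre Him Gam mHre mHim mGam).
pose k := Num.truncn r.
have kr : k%:R <= r <= k.+1%:R.
  by have := truncn_itv r0 => /andP[-> /ltW ->].
have km : (k < minn Mr Mt)%N.
  by rewrite -(ltr_nat R); apply: le_lt_trans rm; case/andP: kr.
(* Minus the slope of [dmt] on [[k, k + 1]], for which [gexp_frac] makes the Chernoff exponent equal
   to [dmt r]. *)
set lam : R := Mr%:R + Mt%:R - 2 * k%:R - 1.
have lam0 : 0 <= lam.
  move: km; rewrite leq_min -(ler_nat R) -[X in _ && X](ler_nat R) => /andP[].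
  by rewrite /lam -natr1; lra.
have [C C0 tb] := gdetH_tail P Hre Him Gam mHre mHim mGam indep dHre dHim lam eta lam0 eta0.
set y := - gexp lam Mr Mt + eta.
(* The factor with [M] converts the power of [snr] into a power of [rho]. *)
exists (C * (2 `^ b^-1) `^ lam * M^-1 `^ y).
  by rewrite !mulr_gt0 ?powR_gt0 ?invr_gt0.
move=> rho Mrho; have r1 := rho1 _ Mrho; have rho0 : 0 < rho := lt_le_trans ltr01 r1.
have s1 : 1 <= snr Mt Mr rho by rewrite ler_pdivlMr // mul1r.
have s0 : 0 < 2 `^ b^-1 * rho `^ r by rewrite mulr_gt0 ?powR_gt0.
apply: le_trans (tb _ _ s1 s0) _.
rewrite powRM ?powR_ge0 // -[(rho `^ r) `^ lam]powRrM -/y powRM ?invr_ge0 ?(ltW rho0) ?(ltW M0) //.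
have -> : - dmt r + eta = r * lam + y.
  by rewrite /dmt -(gexp_frac (Num.truncn r)) // -/k -/lam /y; ring.
by rewrite (powRDp rho (r * lam)) // -/M le_eqVlt; apply/orP; left; apply/eqP; ring.
Qed.

(** [A] is the whole space here: at any rate the distortion is at most that of the side information
    alone, whose mean is about [rho^(- nu)]. *)
Lemma ED_upper_noise r eta : 0 <= r -> 0 < eta ->
  \forall rho \near +oo, ED r rho <= rho `^ (- nu + eta).
Proof.
move=> r0 eta0; pose e := eta / 3.
have e0 : 0 < e by rewrite divr_gt0.
have [L L0 nuL] : exists2 L, (0 < L)%N & nu / L%:R <= e.
  exists (Num.truncn (nu / e)).+1 => //.
  rewrite ler_pdivrMr ?ltr0n // mulrC -ler_pdivrMr //.
  by apply: ltW; apply: truncnS_gt.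
near=> rho.
have rho1 : 1 <= rho by near: rho; exact: nbhs_pinfty_ge.
have rho0 : 0 < rho := lt_le_trans ltr01 rho1.
have : rho `^ (nu - e) <= rhos rho <= rho `^ (nu + e).
  by near: rho; exact: exponent_bounds.
move=> /andP[rs1 rs2].
have bRt : 0 <= b * (r * log2 rho) by apply: rate_ge0 => //; exact: ltW.
have hL : L.+2%:R <= rho `^ e by near: rho; exact: near_powR_ge.
pose V := rho `^ nu.
have V1 : 1 <= V by exact: powR_ge1.
have MV1 : V `^ L%:R^-1 / rhos rho <= rho `^ (- nu + e + e).
  rewrite ler_pdivrMr //; apply: le_trans (ler_wpM2l (powR_ge0 _ _) rs1).
  by rewrite /V -powRrM -powRDp // ler_powR //; lra.
have MV2 : V^-1 <= rho `^ (- nu + e + e) by rewrite /V -powRN ler_powR //; lra.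
have := ED_le_outage P Hre Him Gam mHre mHim mGam indep dGam b eps rho (rhos rho)
  (r * log2 rho) (hrhos rho) bRt V L _ 0 setT (@measurableT _ (g_sigma_algebraType _))
  V1 L0 (lexx _) MV1 MV2.
rewrite add0r /Pr probability_setT mulr1 => h; apply: le_trans (h _) _.
  move=> t g0; rewrite indicE in_setT mul1r add0r.
  by have /andP[] := Dld_le Mt Mr b eps rho (rhos rho) (r * log2 rho) (H t) (Gam t) (hrhos rho) g0 bRt.
apply: le_trans (ler_wpM2r (powR_ge0 _ _) hL) _.
by rewrite -powRDp // ler_powR // /e; lra.
Unshelve. all: by end_near. Qed.

(** Decoded blocks contribute at most [rho^(- b r)], which is [c0]; blocks in outage have a small
    determinant, and [Gam], independent of it, brings the factor [rho^(- nu)]. *)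
Lemma ED_upper_outage r eta : 0 <= r -> 0 < eta ->
  \forall rho \near +oo, ED r rho <= rho `^ (- Num.min (b * r) (dmt r + nu) + eta).
Proof.
move=> r0 eta0; pose e := eta / 4.
have e0 : 0 < e by rewrite divr_gt0.
have [L L0 nuL] : exists2 L, (0 < L)%N & nu / L%:R <= e.
  exists (Num.truncn (nu / e)).+1 => //.
  rewrite ler_pdivrMr ?ltr0n // mulrC -ler_pdivrMr //.
  by apply: ltW; apply: truncnS_gt.
have [C C0 tb] := gdet_dmt r e r0 e0.
near=> rho.
have rhoM : M <= rho by near: rho; apply: nbhs_pinfty_ge; exact: num_real.
have rho1 : 1 <= rho := le_trans M1 rhoM.
have rho0 : 0 < rho := lt_le_trans ltr01 rho1.
have : rho `^ (nu - e) <= rhos rho <= rho `^ (nu + e).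
  by near: rho; exact: exponent_bounds.
move=> /andP[rs1 rs2].
have bRt : 0 <= b * (r * log2 rho) by apply: rate_ge0 => //; exact: ltW.
have hL : 1 + L.+2%:R * C <= rho `^ e by near: rho; exact: near_powR_ge.
pose V := rho `^ nu.
have V1 : 1 <= V by exact: powR_ge1.
have MV1 : V `^ L%:R^-1 / rhos rho <= rho `^ (- nu + e + e).
  rewrite ler_pdivrMr //; apply: le_trans (ler_wpM2l (powR_ge0 _ _) rs1).
  by rewrite /V -powRrM -powRDp // ler_powR //; lra.
have MV2 : V^-1 <= rho `^ (- nu + e + e) by rewrite /V -powRN ler_powR //; lra.
have := ED_le_outage P Hre Him Gam mHre mHim mGam indep dGam b eps rho (rhos rho)
  (r * log2 rho) (hrhos rho) bRt V L _ (rho `^ (- (b * r))) _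
  (smeas_gdet_le Hre Him Gam (snr Mt Mr rho) (2 `^ b^-1 * rho `^ r))
  V1 L0 (powR_ge0 _ _) MV1 MV2.
set A := [set t | _]; move=> h; apply: le_trans (h _) _.
  move=> t g0; rewrite /dist /Dld.
  have rg : 0 < rhos rho * Gam t + 1 by rewrite ltr_wpDl // mulr_ge0 // ltW.
  case: asboolP => ho.
    rewrite indicE mem_set ?mul1r; first by rewrite /Dd pow20 lerDr powR_ge0.
    exact: (outage_gdet Mt Mr b eps hb heps rho (rhos rho) r (H t) (Gam t)).
  rewrite -[X in X <= _]addr0 lerD //; last by rewrite mulr_ge0 // invr_ge0 ltW.
  rewrite /Dd pow2_rate // powRN lef_pV2 ?posrE ?powR_gt0 //.
    by rewrite lerDr mulr_ge0 // ltW.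
  by rewrite ltr_wpDl ?powR_gt0 // mulr_ge0 // ltW.
set mm := Num.min _ _.
have m1 : mm <= b * r by rewrite ge_min lexx.
have m2 : mm <= dmt r + nu by rewrite ge_min lexx orbT.
have p1 : rho `^ (- (b * r)) <= rho `^ (- mm + e + e + e) by rewrite ler_powR //; lra.
have p2 : L.+2%:R * rho `^ (- nu + e + e) * Pr P A <= L.+2%:R * C * rho `^ (- mm + e + e + e).
  apply: le_trans (ler_wpM2l _ (tb rho rhoM)) _; first by rewrite mulr_ge0 ?powR_ge0.
  rewrite mulrACA -powRDp // ler_wpM2l ?mulr_ge0 ?(ltW C0) // ler_powR //; lra.
apply: le_trans (lerD p1 p2) _; rewrite -[X in X + _]mul1r -mulrDl.
apply: le_trans (ler_wpM2r (powR_ge0 _ _) hL) _.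
by rewrite -powRDp // ler_powR // /e; lra.
Unshelve. all: by end_near. Qed.

Lemma ED_lower_noise r eta : 0 <= r -> 0 < eta ->
  \forall rho \near +oo, rho `^ (- Num.max nu (b * r) - eta) <= ED r rho.
Proof.
move=> r0 eta0; pose e := eta / 2.
have e0 : 0 < e by rewrite divr_gt0.
near=> rho.
have rho1 : 1 <= rho by near: rho; exact: nbhs_pinfty_ge.
have rho0 : 0 < rho := lt_le_trans ltr01 rho1.
have : rho `^ (nu - e) <= rhos rho <= rho `^ (nu + e).
  by near: rho; exact: exponent_bounds.
move=> /andP[rs1 rs2].
have bRt : 0 <= b * (r * log2 rho) by apply: rate_ge0 => //; exact: ltW.
have h8 : 8 <= rho `^ e by near: rho; exact: near_powR_ge.
apply: le_trans _ (ED_ge_noise P Hre Him Gam mHre mHim mGam dGam b eps rho (rhos rho)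
  (r * log2 rho) (hrhos rho) bRt).
set mm := Num.max _ _.
have m1 : nu <= mm by rewrite le_max lexx.
have m2 : b * r <= mm by rewrite le_max lexx orbT.
rewrite -opprD powRN lef_pV2 ?posrE ?powR_gt0 //; last first.
  by rewrite mulr_gt0 // addr_gt0 // expR_gt0.
rewrite pow2_rate //.
have p1 : rhos rho <= rho `^ (mm + e) by apply: le_trans rs2 _; rewrite ler_powR //; lra.
have p2 : rho `^ (b * r) <= rho `^ (mm + e) by rewrite ler_powR //; lra.
have p3 : 8 * rho `^ (mm + e) <= rho `^ (mm + eta).
  apply: le_trans (ler_wpM2r (powR_ge0 _ _) h8) _.
  by rewrite -powRDp // ler_powR // /e; lra.
by lra.
Unshelve. all: by end_near. Qed.

Lemma ED_lower_outage r eta : 0 < r -> 0 < eta ->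
  \forall rho \near +oo, rho `^ (- (dmt r + nu) - eta) <= ED r rho.
Proof.
move=> r0 eta0; pose e := eta / 3.
have e0 : 0 < e by rewrite divr_gt0.
pose w : R := Mr%:R * Mt%:R.
have w1 : 1 <= w by rewrite /w -natrM ler1n muln_gt0 hMr hMt.
have w0 : 0 < w := lt_le_trans ltr01 w1.
(* Aiming at a determinant of order [rho^(r - th)] leaves a factor [rho^(b th)] that absorbs [K],
   [eps] and the halving in [gdet_outage]. The bound by [r] keeps the gain at most [r - th], the
   bound by [e / w] keeps the extra cost at most [e]. *)
pose th := Num.min r (e / w).
have th0 : 0 < th by rewrite lt_min r0 divr_gt0.
have thr : th <= r by rewrite ge_min lexx.
have thw : th * w <= e by rewrite -ler_pdivlMr // ge_min lexx orbT.
have al j : 0 <= frac (r - th) j <= 1 := frac01 _ _.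
have [K [c [K0 c0 sb]]] := gdetH_small P Hre Him Gam mHre mHim mGam indep dHre dHim
  (frac (r - th)) al.
have costle : cost (frac (r - th)) Mr Mt <= dmt r + e.
  apply: le_trans (cost_le _ (frac r) th _ _ (ltW th0) _) _; last by rewrite lerD2l.
  move=> j; rewrite /frac; set x := j.+1%:R.
  have [h1|h1] := leP (Num.min 1 (x - (r - th))) 0; first by rewrite addr_ge0 ?le_max ?lexx // ltW.
  rewrite -lerBlDr le_max; apply/orP; right; rewrite le_min.
  have : Num.min 1 (x - (r - th)) <= 1 by rewrite ge_min lexx.
  have : Num.min 1 (x - (r - th)) <= x - (r - th) by rewrite ge_min lexx orbT.
  by move=> *; apply/andP; split; lra.
have gainle : gain (frac (r - th)) Mr Mt <= r - th.
  by apply: le_trans (gain_frac _ _ _) _; rewrite max_r // subr_ge0.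
have cost0 : 0 <= cost (frac (r - th)) Mr Mt.
  by apply: cost_ge0 => j; case/andP: (al j).
have gain0 : 0 <= gain (frac (r - th)) Mr Mt.
  by apply: gain_ge0 => j; case/andP: (al j).
have /andP[pe0 pe1] := @pow2_eps01 R eps heps.
have br0 : 0 < b * r by rewrite mulr_gt0.
have bt0 : 0 < b * th by rewrite mulr_gt0.
near=> rho.
have rhoM : M <= rho by near: rho; apply: nbhs_pinfty_ge; exact: num_real.
have rho1 : 1 <= rho := le_trans M1 rhoM.
have rho0 : 0 < rho := lt_le_trans ltr01 rho1.
have s1 : 1 <= snr Mt Mr rho by rewrite ler_pdivlMr // mul1r.
have s0 : 0 <= snr Mt Mr rho by rewrite (le_trans ler01).
have sr : snr Mt Mr rho <= rho by rewrite ler_pdivrMr // ler_peMr // ltW.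
have : rho `^ (nu - e) <= rhos rho <= rho `^ (nu + e).
  by near: rho; exact: exponent_bounds.
move=> /andP[rs1 rs2].
have bRt : 0 <= b * (r * log2 rho) by apply: rate_ge0 => //; exact: ltW.
have q1 : (pow2 (- eps))^-1 <= rho `^ (b * r) by near: rho; exact: near_powR_ge.
have q2 : K `^ b * 2 / pow2 (- eps) <= rho `^ (b * th) by near: rho; exact: near_powR_ge.
have h8 : 8 / c <= rho `^ e by near: rho; exact: near_powR_ge.
set s := K * snr Mt Mr rho `^ gain (frac (r - th)) Mr Mt.
have sK : s <= K * rho `^ (r - th).
  rewrite /s ler_wpM2l ?(ltW K0) //.
  apply: le_trans (_ : rho `^ gain (frac (r - th)) Mr Mt <= _); last by rewrite ler_powR.
  by rewrite ge0_ler_powR ?nnegrE ?(ltW rho0).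
have := ED_ge_outage P Hre Him Gam mHre mHim mGam indep dGam b eps rho (rhos rho)
  (r * log2 rho) (hrhos rho) bRt _
  (smeas_gdet_le Hre Him Gam (snr Mt Mr rho) s).
set A := [set t | _] => h; apply: le_trans (h _); last first.
  move=> t At g0 grs; apply: gdet_outage => //; first exact: ltW.
    by rewrite -ler_pdivrMr // div1r.
  have G0 : 0 <= gdet (snr Mt Mr rho) (H t) by rewrite (le_trans ler01) // gdet_ge1.
  apply: (@le_trans _ _ ((K * rho `^ (r - th)) `^ b)).
    rewrite ge0_ler_powR ?nnegrE ?(ltW hb) ?mulr_ge0 ?powR_ge0 ?(ltW K0) //.
    exact: le_trans At sK.
  rewrite powRM ?powR_ge0 ?(ltW K0) // -powRrM.
  have -> : b * r = (r - th) * b + b * th by ring.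
  rewrite powRDp //.
  move: q2; rewrite ler_pdivrMr // => q2.
  have z0 : 0 <= rho `^ ((r - th) * b) by exact: powR_ge0.
  have := ler_wpM2l z0 q2; lra.
have tb := sb _ s1; rewrite -/s -/A in tb.
have p1 : c * rho `^ (- (dmt r + e)) <= Pr P A.
  apply: le_trans tb; rewrite ler_wpM2l ?(ltW c0) //.
  apply: (@le_trans _ _ (rho `^ (- cost (frac (r - th)) Mr Mt))); first by rewrite ler_powR // lerN2.
  rewrite !powRN lef_pV2 ?posrE ?powR_gt0 ?(lt_le_trans ltr01) //.
  by rewrite ge0_ler_powR ?nnegrE ?(ltW rho0).
have p2 : 1 + rhos rho <= 2 * rho `^ (nu + e).
  have : 1 <= rho `^ (nu + e) by rewrite powR_ge1 // addr_ge0 // ltW.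
  lra.
have d0 : 0 < 4 * (1 + rhos rho) by rewrite mulr_gt0 // addr_gt0.
rewrite ler_pdivlMr //; apply: le_trans p1.
apply: (@le_trans _ _ (rho `^ (- (dmt r + nu) - eta) * (8 * rho `^ (nu + e)))).
  by rewrite ler_wpM2l ?powR_ge0 //; lra.
rewrite mulrCA -powRDp //.
move: h8; rewrite ler_pdivrMr // => h8.
have z0 : 0 <= rho `^ (- (dmt r + nu) - eta + (nu + e)) by exact: powR_ge0.
apply: le_trans (ler_wpM2r z0 h8) _.
by rewrite mulrAC mulrC ler_wpM2l ?(ltW c0) // -powRDp // ler_powR // /e; lra.
Unshelve. all: by end_near. Qed.

Lemma ED_exponent r : 0 <= r ->
  (fun rho => - log2 (ED r rho) / log2 rho) @ +oo --> expo r.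
Proof.
move=> r0; apply: exponent_cvg => eta eta0.
have low : \forall rho \near +oo, rho `^ (- (expo r + eta)) <= ED r rho.
  rewrite opprD /expo; have [h|h] := leP (Num.max nu (b * r)) (dmt r + nu).
    exact: ED_lower_noise.
  apply: ED_lower_outage => //.
  (* This branch excludes [r = 0], where the first term of the minimum is [nu <= dmt 0 + nu]. *)
  rewrite lt_neqAle r0 andbT; apply/eqP => r00; move: h; rewrite -r00 mulr0.
  by rewrite max_l // ltNge lerDr dmt_ge0.
have upp : \forall rho \near +oo, ED r rho <= rho `^ (- (expo r - eta)).
  (* If [b r <= nu] the minimum is [nu], as [dmt >= 0]; otherwise the inner maximum is [b r]. *)
  rewrite opprB addrC /expo; have [h|h] := leP (b * r) nu.
    rewrite min_l ?lerDr ?dmt_ge0 //; exact: ED_upper_noise.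
  exact: ED_upper_outage.
by near=> rho; apply/andP; split; near: rho.
Unshelve. all: by end_near. Qed.

End Exponent.

(** * Optimisation over the rate *)

Lemma Phi_symm {R : realType} (Mt Mr k : nat) :
  Phi Mt Mr k = (Mr%:R - k%:R) * (Mt%:R - k%:R) :> R.
Proof. by rewrite /Phi /Mhi /Mlo; case: leqP => _ //; rewrite mulrC. Qed.

Lemma Ups_symm {R : realType} (Mt Mr k : nat) :
  Ups Mt Mr k = Mr%:R + Mt%:R - 2 * k%:R - 1 :> R.
Proof. by rewrite /Ups /Mhi /Mlo; case: leqP => _ //; rewrite [Mt%:R + _]addrC. Qed.

Theorem theorem2 (Mt Mr : nat) (hMt : (1 <= Mt)%N) (hMr : (1 <= Mr)%N)
  (d : measure_display) (T : measurableType d) (R : realType) (P : probability T R)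
  (Hre Him : 'I_Mr -> 'I_Mt -> T -> R) (Gam : T -> R)
  (mHre : forall i j, measurable_fun setT (Hre i j))
  (mHim : forall i j, measurable_fun setT (Him i j))
  (mGam : measurable_fun setT Gam)
  (indep : mutually_independent P (rv_family Hre Him Gam))
  (dHre : forall i j B, measurable B ->
     P (Hre i j @^-1` B) = normal_prob 0 (Num.sqrt (2^-1)) B)
  (dHim : forall i j B, measurable B ->
     P (Him i j @^-1` B) = normal_prob 0 (Num.sqrt (2^-1)) B)
  (dGam : forall B, measurable B -> P (Gam @^-1` B) = exponential_prob 1 B)
  (nu : R) (hnu : 0 <= nu) (rhos : R -> R) (hrhos : forall rho, 0 < rhos rho)
  (hrhos_exp : (fun rho => log2 (rhos rho) / log2 rho) @ +oo --> nu)
  (eps : R) (heps : 0 < eps)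
  (b : R) (hb : 0 < b) (k : nat) (hk : (k < Mlo Mt Mr)%N)
  (hb_lo : (Phi Mt Mr k.+1 + nu) / k.+1%:R <= b)
  (hb_hi : k = 0%N \/ b < (Phi Mt Mr k + nu) / k%:R) :
  exists e : R -> R,
    (forall r, 0 <= r ->
       (fun rho => - log2 (ED_ld P Hre Him Gam b eps (rhos rho) rho (r * log2 rho))
                   / log2 rho) @ +oo --> e r)
    /\ ereal_sup [set (e r)%:E | r in [set r : R | 0 <= r]] = (Delta_ld Mt Mr k b nu)%:E.
Proof.
exists (@expo Mt Mr R nu b); split=> [r r0|].
  exact: ED_exponent.
have km : (k < minn Mr Mt)%N by rewrite minnC.
have Phi_pred : Phi Mt Mr k = Phi Mt Mr k.+1 + Ups Mt Mr k :> R.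
  by rewrite !Phi_symm Ups_symm -natr1; ring.
have U0 : 0 < Ups Mt Mr k :> R.
  have : k.+1%:R <= Mr%:R :> R by rewrite ler_nat (leq_trans km) // geq_minl.
  have : k.+1%:R <= Mt%:R :> R by rewrite ler_nat (leq_trans km) // geq_minr.
  by rewrite Ups_symm -natr1; lra.
set U := Ups Mt Mr k in Phi_pred U0.
have Ub0 : 0 < U + b by rewrite addr_gt0.
(* the rate at which the distortion exponents [b r] of the quantization error
   and [dmt r + nu] of the outage event balance *)
pose rs := (Phi Mt Mr k + k%:R * U + nu) / (U + b).
have rsE : rs * (U + b) = Phi Mt Mr k + k%:R * U + nu by rewrite divfK // gt_eqF.
(* The ends of the interval for [b] place [rs] in [[k, k + 1]], where [cost_frac k] computes
   [dmt]. *)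
have rs_hi : rs <= k.+1%:R.
  rewrite ler_pdivrMr //; move: hb_lo; rewrite ler_pdivrMr ?ltr0n //.
  by rewrite Phi_pred -natr1; nra.
have rs_lo : k%:R <= rs.
  rewrite ler_pdivlMr //; case: hb_hi => [->|].
    by rewrite !mul0r addr0 addr_ge0 // Phi_symm !subr0 mulr_ge0.
  case: (posnP k) => [->|k0].
    by rewrite !mul0r addr0 addr_ge0 // Phi_symm !subr0 mulr_ge0.
  by rewrite ltr_pdivlMr ?ltr0n // => h; rewrite mulrDr [k%:R * b]mulrC; lra.
have rs0 : 0 <= rs by apply: le_trans rs_lo.
have dmt_rs : dmt (Mt := Mt) (Mr := Mr) rs + nu = b * rs.
  rewrite /dmt (cost_frac k) ?rs_lo //.
  rewrite -Ups_symm -Phi_symm -/U -natr1.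
  by move: rsE; rewrite Phi_pred; nra.
have brs : nu <= b * rs by rewrite -dmt_rs lerDr dmt_ge0.
have DE : Delta_ld Mt Mr k b nu = b * rs.
  by rewrite /Delta_ld -/U -mulrA -/rs max_r.
rewrite DE; apply/eqP; rewrite eq_le; apply/andP; split.
  (* Up to [rs] the first term of [expo] is at most [b * rs]; beyond [rs] the second one is, because
     [dmt] is nonincreasing ([cost_le] with [eta = 0]). *)
  apply: ub_ereal_sup => _ [r /= r0 <-]; rewrite lee_fin /expo ge_min.
  have [rr|rr] := leP r rs.
    by rewrite ge_max brs ler_wpM2l // ltW.
  apply/orP; right; rewrite -dmt_rs lerD2r /dmt.
  have := cost_le (frac r) (frac rs) 0 Mr Mt (lexx _).
  rewrite mul0r addr0; apply => j; rewrite addr0 /frac.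
  by apply: le_max2 => //; apply: le_min2 => //; rewrite lerD2l lerN2 ltW.
apply: ereal_sup_ubound; exists rs => //=; congr EFin.
by rewrite /expo dmt_rs max_r // minxx.
Qed.
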